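(* Let $\bar z(\cdot)=(\bar x(\cdot),\bar y(\cdot),\bar u(\cdot),\bar a(\cdot),\bar b(\cdot))$ be a relaxed intermediate local minimizer of problem $(P)$, and suppose that the standing assumptions (H1), (H2), (H3) are satisfied around $\bar z(\cdot)$. Then for all sufficiently large $k\in\mathbb{N}$ the discrete-time problem $(P_k)$ has an optimal solution. (All notions are defined in the context.)
   Context: $T>0$ is fixed; $g_1,\dots,g_s:\mathbb{R}^n\to\mathbb{R}$, $C:=\{x\in\mathbb{R}^n: g_i(x)\ge 0,\ i=1,\dots,s\}$, $C(u):=C+u$, and given $u(\cdot)$, $C(t):=C(u(t))$. Further $f_1:\mathbb{R}^{m+n}\to\mathbb{R}^n$, $f_2:\mathbb{R}^{d+n}\to\mathbb{R}^n$, $\varphi:\mathbb{R}^n\to(-\infty,\infty]$, $l_0$ a function of $(t,x,u,a,b,\dot x,\dot u,\dot a,\dot b)\in[0,T]\times\mathbb{R}^{4n+2m+2d}$, and $x_0\in\mathbb{R}^n$ is fixed. Normal cone: for $\Omega\subset\mathbb{R}^n$ closed and $\bar x\in\Omega$, $N_\Omega(\bar x)$ is the set of $v$ for which there are $x_k\to\bar x$, $w_k$ in the Euclidean projection set $\Pi_\Omega(x_k)$, and $\alpha_k\ge 0$ with $\alpha_k(x_k-w_k)\to v$; $N_\Omega(\bar x):=\emptyset$ for $\bar x\notin\Omega$. Problem $(P)$: minimize $J[z]:=\varphi(x(T))+\int_0^T l(t,z(t),\dot z(t))\,dt$, where $z=(x,y,u,a,b)$ and $l(t,z,\dot z):=l_0(t,x,u,a,b,\dot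 x,\dot u,\dot a,\dot b)$, over feasible solutions, i.e. $z(\cdot)\in W^{1,2}([0,T],\mathbb{R}^{3n+m+d})$ with $$-\dot x(t)\in N_{C(u(t))}(x(t))+f_1(a(t),x(t))+y(t),\quad \dot y(t)=f_2(b(t),x(t))\ \text{ a.e. }t\in[0,T],\quad x(0)=x_0\in C(0),\ y(0)=0.$$ Equivalently $-\dot z(t)\in G(z(t))$ a.e. with $G(z):=\big(N_{C(u)}(x)+f_1(a,x)+y\big)\times\{-f_2(b,x)\}\times\mathbb{R}^n\times\mathbb{R}^m\times\mathbb{R}^d$. Relaxation: let $l_G(t,z,\upsilon):=l(t,z,\upsilon)$ if $-\upsilon\in G(z)$ and $+\infty$ otherwise; let $\hat l_G$ be the biconjugate of $l_G$ in the velocity variable $\upsilon$, and $\hat J[z]:=\varphi(x(T))+\int_0^T\hat l_G(t,z(t),\dot z(t))\,dt$. A feasible solution $\bar z(\cdot)$ of $(P)$ is a relaxed intermediate local minimizer (r.i.l.m.) if $J[\bar z]=\hat J[\bar z]$ and there is $\varepsilon>0$ such that $J[\bar z]\le J[z]$ for every feasible $z(\cdot)$ of $(P)$ with $\|z(t)-\bar z(t)\|<\varepsilon$ on $[0,T]$ and $\int_0^T\|\dot z(t)-\dot{\bar z}(t)\|^2dt<\varepsilon$. Discrete problem $(P_k)$ associated with $\bar z(\cdot)$ and its $\varepsilon$: let $h_k:=T/k$ and $0=t^k_0<\dots<t^k_k=T$ be the mesh with steps at most $h_k$ (so $t^k_j=jh_k$). Over $z^k=(x^k_j,y^k_j,u^k_j,a^k_j,b^k_j)_{j=0,\dots,k}$,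 with $z^k_j:=(x^k_j,y^k_j,u^k_j,a^k_j,b^k_j)$, minimize $$J_k(z^k):=\varphi(x^k_k)+h_k\sum_{j=0}^{k-1}l\Big(t^k_j,z^k_j,\tfrac{z^k_{j+1}-z^k_j}{h_k}\Big)+\frac12\sum_{j=0}^{k-1}\int_{t^k_j}^{t^k_{j+1}}\Big\|\tfrac{z^k_{j+1}-z^k_j}{h_k}-\dot{\bar z}(t)\Big\|^2dt$$ subject to: $x^k_{j+1}\in x^k_j-h_kF_h(z^k_j)$ for $j=0,\dots,k-1$, where $F_h(z^k_j):=N_{C(u^k_j)}(x^k_j)+f_1(a^k_j,x^k_j)+y^k_{j+1}$; $y^k_{j+1}=y^k_j+h_kf_2(b^k_j,x^k_j)$ for $j=0,\dots,k-1$; $(x^k_0,y^k_0,u^k_0,a^k_0,b^k_0)=(x_0,0,\bar u(0),\bar a(0),\bar b(0))$; $g_i(x^k_k-u^k_k)\ge 0$ for $i=1,\dots,s$; $\|z^k_j-\bar z(t^k_j)\|\le\varepsilon/2$ for $j=0,\dots,k-1$; and $\sum_{j=0}^{k-1}\int_{t^k_j}^{t^k_{j+1}}\big\|\frac{z^k_{j+1}-z^k_j}{h_k}-\dot{\bar z}(t)\big\|^2dt\le\varepsilon/2$. (H1) There are $c>0$, $M_1,M_2,M_3>0$ and open sets $A_i\subset V_i$ ($i=1,\dots,s$) with $C\subset A_i$ and $d_H(A_i,\mathbb{R}^n\setminus V_i)>c$ ($d_H$ the Hausdorff distance) such that each $g_i$ is twice continuously differentiable with $M_1\le\|\nabla g_i(x)\|\le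 M_2$ and $\|\nabla^2 g_i(x)\|\le M_3$ for all $x\in V_i$. Furthermore there are $\beta,\rho>0$ with $\sum_{i\in I_\rho(x)}\lambda_i\|\nabla g_i(x)\|\le\beta\big\|\sum_{i\in I_\rho(x)}\lambda_i\nabla g_i(x)\big\|$ whenever $x\in C$ and $\lambda_i\ge 0$, where $I_\rho(x):=\{i: g_i(x)\le\rho\}$. (H2) $f_1,f_2$ are continuous and: (i) there exist $\alpha_1,\alpha_2\ge 0$ such that for control functions $(u,a,b)\in W^{1,2}([0,T],\mathbb{R}^{n+m+d})$ one has $\|f_1(a(t),x)\|\le\|a(t)\|+\alpha_1\|x\|$ and $\|f_2(b(t),x)\|\le\|b(t)\|+\alpha_2\|x\|$ for all $t\in[0,T]$, $x\in\bigcup_{\tau\in[0,T]}C(u(\tau))$; (ii) for any $r_1>0$ and $(a(\cdot),b(\cdot))\in W^{1,2}([0,T],\mathbb{R}^{m+d})$ there exist $L,L_1,L_2\ge 0$ with $\|f_1(a(t),x_1)-f_1(a(t),x_2)\|\le L\|x_1-x_2\|$ and $\|f_2(b(t),x_1)-f_2(b(t),x_2)\|\le L_1\|x_1-x_2\|$ for all $t\in[0,T]$, $\|x_1\|,\|x_2\|\le r_1$, and $\|f_2(b_1,x)-f_2(b_2,x)\|\le L_2\|b_1-b_2\|$ for all $b_1,b_2\in\mathbb{R}^d$, $\|x\|\le r_1$. (H3) $\varphi$ is lower semicontinuous; $l_0$ (with values in $[-\infty,\infty]$) is lower semicontinuous with respect to all variables but time, continuous in $t$, and majorized by a summable function on $[0,T]$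 along reference curves; $l_0(t,\cdot)$ is bounded from below on bounded sets for a.e. $t\in[0,T]$. *)

(* Defs.v *)
From HB Require Import structures.
From mathcomp Require Import all_boot all_order all_algebra.
From mathcomp Require Import all_classical all_reals all_analysis.

Set Implicit Arguments.
Unset Strict Implicit.
Unset Printing Implicit Defensive.

Import Order.TTheory GRing.Theory Num.Theory.
Import numFieldNormedType.Exports.

Local Open Scope classical_set_scope.
Local Open Scope ring_scope.

(** * Euclidean geometry of R^N *)

(* The library norm [`|v|] on row vectors is the max norm; every norm in the
   problem is the Euclidean one. *)
Definition dotp (R : realType) (N : nat) (v w : 'rV[R]_N) : R :=
  \sum_(i < N) v 0 i * w 0 i.

Definition enorm (R : realType) (N : nat) (v : 'rV[R]_N) : R :=
  Num.sqrt (dotp v v).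

(* Operator norm induced by [enorm]. *)
Definition opnorm (R : realType) (N : nat) (A : 'M[R]_N) : R :=
  sup [set enorm (v *m A) | v in [set v : 'rV[R]_N | enorm v <= 1]].

Definition edist_set (R : realType) (N : nat) (a : 'rV[R]_N)
    (B : set 'rV[R]_N) : \bar R :=
  ereal_inf [set (enorm (a - b))%:E | b in B].

(* Hausdorff distance; [ereal_inf set0 = +oo], so that the distance of a
   nonempty set to the empty set is [+oo]. *)
Definition hausdorff_dist (R : realType) (N : nat)
    (A B : set 'rV[R]_N) : \bar R :=
  maxe (ereal_sup [set edist_set a B | a in A])
       (ereal_sup [set edist_set b A | b in B]).

Definition proj_set (R : realType) (N : nat) (Om : set 'rV[R]_N)
    (x : 'rV[R]_N) : set 'rV[R]_N :=
  [set w | Om w /\ forall w', Om w' -> enorm (x - w) <= enorm (x - w')].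

(* The limiting normal cone is a notion for closed sets only; the conjunct
   [closed Om] makes the operator total, with empty values on the other sets. *)
Definition normal_cone (R : realType) (N : nat) (Om : set 'rV[R]_N)
    (xb : 'rV[R]_N) : set 'rV[R]_N :=
  [set v | [/\ closed Om, Om xb &
    exists (x w : nat -> 'rV[R]_N) (alpha : nat -> R),
      [/\ x @ \oo --> xb,
          forall k, proj_set Om (x k) (w k),
          forall k, 0 <= alpha k &
          (fun k => alpha k *: (x k - w k)) @ \oo --> v]]].

(** * Differential calculus *)

Definition grad (R : realType) (N : nat) (g : 'rV[R]_N -> R)
    (x : 'rV[R]_N) : 'rV[R]_N :=
  \row_j 'D_(delta_mx 0 j) g x.

Definition hess (R : realType) (N : nat) (g : 'rV[R]_N -> R)
    (x : 'rV[R]_N) : 'M[R]_N :=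
  'J (grad g) x.

(* To be used on open sets [V]. *)
Definition C2_on (R : realType) (N : nat) (g : 'rV[R]_N -> R)
    (V : set 'rV[R]_N) : Prop :=
  forall x, V x ->
    [/\ differentiable g x, differentiable (grad g) x &
        {for x, continuous (hess g)}].

(** * The space W^{1,2}([0,T], R^N) *)

(* The absolutely continuous representatives: indefinite integrals of square
   integrable functions.  Their derivative, defined almost everywhere, is the
   library's [derive1 z]. *)
Definition W12 (R : realType) (T : R) (N : nat) (z : R -> 'rV[R]_N) : Prop :=
  exists v : R -> 'rV[R]_N, forall i : 'I_N,
    [/\ measurable_fun `[0, T] (fun t => v t 0 i),
        (@lebesgue_measure R).-integrable `[0, T]
          (fun t => ((v t 0 i) ^+ 2)%:E) &
        forall t, t \in `[0, T] ->
          z t 0 i =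
          z 0 0 i + \int[@lebesgue_measure R]_(s in `[0, t]) v s 0 i].

(** * Convex conjugation *)

Definition conjugate (R : realType) (N : nat) (f : 'rV[R]_N -> \bar R)
    (p : 'rV[R]_N) : \bar R :=
  ereal_sup [set ((dotp p v)%:E - f v)%E | v in setT].

Definition biconjugate (R : realType) (N : nat) (f : 'rV[R]_N -> \bar R) :
    'rV[R]_N -> \bar R :=
  conjugate (conjugate f).

(** * Problem (P) *)

Section blocks.
Context {R : realType} {n m d : nat}.

(* A point (or velocity) z = (x, y, u, a, b) of R^{3n+m+d}. *)
Definition zvec := 'rV[R]_(n + (n + (n + (m + d)))).

Implicit Type z : zvec.

Definition zx z : 'rV[R]_n := lsubmx z.
Definition zy z : 'rV[R]_n := lsubmx (rsubmx z).
Definition zu z : 'rV[R]_n := lsubmx (rsubmx (rsubmx z)).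
Definition za z : 'rV[R]_m := lsubmx (rsubmx (rsubmx (rsubmx z))).
Definition zb z : 'rV[R]_d := rsubmx (rsubmx (rsubmx (rsubmx z))).

Definition zxuab z : 'rV[R]_(n + (n + (m + d))) :=
  row_mx (zx z) (row_mx (zu z) (row_mx (za z) (zb z))).

End blocks.

Arguments zvec : clear implicits.

Record problem (R : realType) (n m d s : nat) := Problem {
  horizon : R;
  horizon_gt0 : 0 < horizon;
  gfun : 'I_s -> 'rV[R]_n -> R;
  f1 : 'rV[R]_(m + n) -> 'rV[R]_n;
  f2 : 'rV[R]_(d + n) -> 'rV[R]_n;
  phi : 'rV[R]_n -> \bar R;
  phi_gtNy : forall x, (-oo < phi x)%E;
  l0 : R -> 'rV[R]_((n + (n + (m + d))) + (n + (n + (m + d)))) -> \bar R;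
  x0 : 'rV[R]_n
}.

Section problem_P.
Context {R : realType} {n m d s : nat}.
Variable P : problem R n m d s.

Local Notation T := (horizon P).
Local Notation I0T := (`[0%R, T]%classic : set R).
Local Notation mu := (@lebesgue_measure R).
Local Notation zvec := (zvec R n m d).

Definition Cset : set 'rV[R]_n := [set x | forall i, 0 <= gfun P i x].

Definition Cu (u : 'rV[R]_n) : set 'rV[R]_n := [set x + u | x in Cset].

Definition f1ax (a : 'rV[R]_m) (x : 'rV[R]_n) := f1 P (row_mx a x).
Definition f2bx (b : 'rV[R]_d) (x : 'rV[R]_n) := f2 P (row_mx b x).

Definition lrun (t : R) (z dz : zvec) : \bar R :=
  l0 P t (row_mx (zxuab z) (zxuab dz)).

(* In [\bar R] the library has [+oo - oo = -oo]. *)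
Definition J (z : R -> zvec) : \bar R :=
  (phi P (zx (z T)) + \int[mu]_(t in I0T) lrun t (z t) (derive1 z t))%E.

Definition feasible (z : R -> zvec) : Prop :=
  [/\ W12 T z,
      {ae mu, forall t, t \in `[0, T] ->
        [set nu + f1ax (za (z t)) (zx (z t)) + zy (z t)
           | nu in normal_cone (Cu (zu (z t))) (zx (z t))]
          (- zx (derive1 z t))},
      {ae mu, forall t, t \in `[0, T] ->
        zy (derive1 z t) = f2bx (zb (z t)) (zx (z t))},
      zx (z 0) = x0 P /\ Cu (zu (z 0)) (x0 P) &
      zy (z 0) = 0].

(** ** Relaxation *)

Definition G (z : zvec) : set zvec :=
  [set w | [set nu + f1ax (za z) (zx z) + zy z
              | nu in normal_cone (Cu (zu z)) (zx z)] (zx w) /\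
           zy w = - f2bx (zb z) (zx z)].

Definition lG (t : R) (z v : zvec) : \bar R :=
  if `[< G z (- v) >] then lrun t z v else +oo%E.

Definition lG_hat (t : R) (z : zvec) : zvec -> \bar R :=
  biconjugate (lG t z).

Definition J_hat (z : R -> zvec) : \bar R :=
  (phi P (zx (z T)) + \int[mu]_(t in I0T) lG_hat t (z t) (derive1 z t))%E.

(* [zbar] is a relaxed intermediate local minimizer, with radius [eps]. *)
Definition rilm (zbar : R -> zvec) (eps : R) : Prop :=
  [/\ feasible zbar, J zbar = J_hat zbar, 0 < eps &
      forall z, feasible z ->
        (forall t, t \in `[0, T] -> enorm (z t - zbar t) < eps) ->
        (\int[mu]_(t in I0T) (enorm (derive1 z t - derive1 zbar t) ^+ 2)%R%:E
           < eps%:E)%E ->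
        (J zbar <= J z)%E].

(** ** Standing assumptions *)

Definition H1 : Prop :=
  (exists (c M1 M2 M3 : R) (A V : 'I_s -> set 'rV[R]_n),
    [/\ 0 < c, 0 < M1, 0 < M2, 0 < M3 &
    forall i,
      [/\ open (A i), open (V i), A i `<=` V i, Cset `<=` A i &
      [/\ (c%:E < hausdorff_dist (A i) (~` V i))%E,
          C2_on (gfun P i) (V i) &
          forall x, V i x ->
            [/\ M1 <= enorm (grad (gfun P i) x),
                enorm (grad (gfun P i) x) <= M2 &
                opnorm (hess (gfun P i) x) <= M3]]]]) /\
  (exists beta rho : R, [/\ 0 < beta, 0 < rho &
    forall x (lam : 'I_s -> R), Cset x -> (forall i, 0 <= lam i) ->
      \sum_(i < s | gfun P i x <= rho) lam i * enorm (grad (gfun P i) x)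
      <= beta *
         enorm (\sum_(i < s | gfun P i x <= rho) lam i *: grad (gfun P i) x)]).

Definition H2_growth : Prop :=
  exists alpha1 alpha2 : R, [/\ 0 <= alpha1, 0 <= alpha2 &
    forall (u : R -> 'rV[R]_n) (a : R -> 'rV[R]_m) (b : R -> 'rV[R]_d),
      W12 T u -> W12 T a -> W12 T b ->
      forall t x, t \in `[0, T] -> (\bigcup_(tau in I0T) Cu (u tau)) x ->
        enorm (f1ax (a t) x) <= enorm (a t) + alpha1 * enorm x /\
        enorm (f2bx (b t) x) <= enorm (b t) + alpha2 * enorm x].

Definition H2_lipschitz : Prop :=
  forall (r1 : R) (a : R -> 'rV[R]_m) (b : R -> 'rV[R]_d),
    0 < r1 -> W12 T a -> W12 T b ->
    exists L L1 L2 : R, [/\ 0 <= L, 0 <= L1, 0 <= L2,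
      forall t x1 x2, t \in `[0, T] -> enorm x1 <= r1 -> enorm x2 <= r1 ->
        enorm (f1ax (a t) x1 - f1ax (a t) x2) <= L * enorm (x1 - x2) /\
        enorm (f2bx (b t) x1 - f2bx (b t) x2) <= L1 * enorm (x1 - x2) &
      forall b1 b2 x, enorm x <= r1 ->
        enorm (f2bx b1 x - f2bx b2 x) <= L2 * enorm (b1 - b2)].

Definition H2 : Prop :=
  [/\ continuous (f1 P), continuous (f2 P), H2_growth & H2_lipschitz].

(* The reference curve along which [l0] is majorized is [zbar]. *)
Definition H3 (zbar : R -> zvec) : Prop :=
  [/\ lower_semicontinuous (phi P),
      forall t, t \in `[0, T] -> lower_semicontinuous (l0 P t),
      forall p, {within I0T, continuous (fun t => l0 P t p)},
      exists psi : R -> R,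
        mu.-integrable I0T (EFin \o psi) /\
        {ae mu, forall t, t \in `[0, T] ->
          (lrun t (zbar t) (derive1 zbar t) <= (psi t)%:E)%E} &
      {ae mu, forall t, t \in `[0, T] ->
        forall r : R, exists c : R,
          forall p, enorm p <= r -> (c%:E <= l0 P t p)%E}].

(** ** The discrete problem (P_k) *)

Definition hstep (k : nat) : R := T / k%:R.

Definition mesh (k j : nat) : R := j%:R * hstep k.

(* Discrete trajectories [z 0, ..., z k] are represented by functions on [nat],
   of which only the values at [j <= k] are used below. *)
Definition dquot (k : nat) (z : nat -> zvec) (j : nat) : zvec :=
  (hstep k)^-1 *: (z j.+1 - z j).

Definition velocity_gap (zbar : R -> zvec) (k : nat) (z : nat -> zvec) :
    \bar R :=
  (\sum_(j < k) \int[mu]_(t in `[mesh k j, mesh k j.+1])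
     (enorm (dquot k z j - derive1 zbar t) ^+ 2)%R%:E)%E.

Definition Jk (zbar : R -> zvec) (k : nat) (z : nat -> zvec) : \bar R :=
  (phi P (zx (z k))
   + (hstep k)%:E * (\sum_(j < k) lrun (mesh k j) (z j) (dquot k z j))
   + (2^-1)%:E * velocity_gap zbar k z)%E.

Definition Fh (z : nat -> zvec) (j : nat) : set 'rV[R]_n :=
  [set nu + f1ax (za (z j)) (zx (z j)) + zy (z j.+1)
     | nu in normal_cone (Cu (zu (z j))) (zx (z j))].

Definition feasible_k (zbar : R -> zvec) (eps : R) (k : nat)
    (z : nat -> zvec) : Prop :=
  [/\ forall j, (j < k)%N ->
        [set zx (z j) - hstep k *: v | v in Fh z j] (zx (z j.+1)),
      forall j, (j < k)%N ->
        zy (z j.+1) = zy (z j) + hstep k *: f2bx (zb (z j)) (zx (z j)),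
      [/\ zx (z 0%N) = x0 P, zy (z 0%N) = 0, zu (z 0%N) = zu (zbar 0),
          za (z 0%N) = za (zbar 0) & zb (z 0%N) = zb (zbar 0)],
      forall i, 0 <= gfun P i (zx (z k) - zu (z k)) &
      (forall j, (j < k)%N -> enorm (z j - zbar (mesh k j)) <= eps / 2) /\
      (velocity_gap zbar k z <= (eps / 2)%:E)%E].

Definition optimal_k (zbar : R -> zvec) (eps : R) (k : nat)
    (z : nat -> zvec) : Prop :=
  feasible_k zbar eps k z /\
  forall z', feasible_k zbar eps k z' -> (Jk zbar k z <= Jk zbar k z')%E.

End problem_P.

(* Main.v *)
Require Import Defs.
From mathcomp Require Import all_boot all_order all_algebra.
From mathcomp Require Import all_classical all_reals all_analysis.
From mathcomp Require Import measurable_realfun ring lra.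
Set Implicit Arguments.
Unset Strict Implicit.
Unset Printing Implicit Defensive.
Import Order.TTheory GRing.Theory Num.Theory.
Import numFieldNormedType.Exports.
Local Open Scope classical_set_scope.
Local Open Scope ring_scope.

(** A minimizer exists because the discrete cost is lower semicontinuous and the
    set of feasible discrete trajectories is compact and, for large [k], nonempty.

    Compactness ([feasible_k_bounded], [closed_feasible_k]). The nodes before the
    last one lie in a tube around [zbar], and the last one is bounded through the
    velocity gap. The constraints are closed: the velocity gap is a quadratic
    polynomial in the nodes ([velocity_gapE]), [f1] and [f2] are continuous, and the
    inclusion says that a vector depending continuously on the nodes belongs to the
    limiting normal cone to C at x - u, a cone whose graph is closed
    ([closed_normal_cone], [normal_cone_shift]). That C is closed follows from the
    existence of one feasible trajectory, since the normal cone to a set that is not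
    closed is empty. The cost is a sum of lower semicontinuous terms ([lsc_Jk]).

    Nonemptiness ([feasible_k_exists]). The reference curve is sampled at the times
    [tau j = j h - h + th], with one offset [th] in [[0, h]]; the curve is extended
    by a constant to negative times. Averaging over [th], together with the density
    of continuous functions in L^2, yields an offset such that the [tau j] avoid the
    null set where the dynamics fail, and that both the sampled velocities and the
    difference quotients of the samples approximate the velocity in L^2
    ([select_offset], [sampling]). The controls a, b are the sampled ones. The states
    x, y follow an explicit Euler scheme which keeps the sampled normal vectors, and
    u is chosen so that x - u is the sampled x - u; as the normal cone to C + u at x
    depends only on x - u, the sampled normal vectors remain normal
    ([sampled_traj_feasible]). The discrete Gronwall inequality ([euler_stability])
    keeps the states close to the curve, and then the velocities as well
    ([euler_velocity]), so that the tube and the velocity constraints hold for fine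
    meshes ([sampled_traj_close], [sampled_traj_gap]). *)

(** * Lower semicontinuous functions *)

Section lsc.
Context {R : realType} {X : topologicalType}.
Implicit Types f g : X -> \bar R.

(** The sets of the points of [K] where [f] is at most [f y], for [y] in [K],
    form a filter base; a cluster point of it minimizes [f]. *)
Lemma compact_lsc_min f (K : set X) : lower_semicontinuous f -> compact K ->
  K !=set0 -> exists2 x, K x & forall y, K y -> (f x <= f y)%E.
Proof.
move=> lf cK [x0 Kx0].
pose B (y : X) := [set x | K x /\ (f x <= f y)%E].
have FF : ProperFilter (filter_from K B).
  apply: filter_from_proper; last first.
    by move=> y Ky; exists y.
  apply: filter_from_filter; first by exists x0.
  move=> y z Ky Kz; have [yz|/ltW zy] := leP (f y) (f z).
    by exists y => // x [Kx xy]; split; split => //; apply: le_trans yz.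
  by exists z => // x [Kx xy]; split; split => //; apply: le_trans zy.
have [|p [Kp clp]] := cK _ FF; first by exists x0 => // x [].
exists p => // y Ky; rewrite leNgt; apply/negP => fyp.
have [a fya afp] : exists2 a : R, (f y <= a%:E)%E & (a%:E < f p)%E.
  case: (f y) fyp => [r|/lt_geF|]; [by exists r|by rewrite leey|].
  case: (f p) => [r _|_|//]; last by exists 0; rewrite ?leNye ?ltry.
  by exists (r - 1); rewrite ?leNye// lte_fin gtrBl.
have [U pU Ua] := lf p a afp.
have [z [[_ zy] /Ua]] := clp (B y) U (ex_intro2 _ _ y Ky (fun _ => id)) pU.
by rewrite ltNge (le_trans zy).
Qed.

(** No condition on the infinite values is needed: since [+oo - oo] is [-oo], the
    inequality [a < f x + g x] forces both values to exceed [-oo]. *)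
Lemma lscD f g : lower_semicontinuous f -> lower_semicontinuous g ->
  lower_semicontinuous (fun x => f x + g x)%E.
Proof.
move=> lf lg x a afg.
have [b [c [bf cg abc]]] : exists b c : R,
    [/\ (b%:E < f x)%E, (c%:E < g x)%E & a <= b + c].
  case: (f x) afg => [r||]; case: (g x) => [s||] //=.
  - rewrite -EFinD lte_fin => ars.
    exists (r - (r + s - a) / 2), (s - (r + s - a) / 2).
    by split; rewrite ?lte_fin; lra.
  - by move=> _; exists (r - 1), (a - (r - 1)); split; rewrite ?ltry ?lte_fin //; lra.
  - by move=> _; exists (a - (s - 1)), (s - 1); split; rewrite ?ltry ?lte_fin //; lra.
  - by move=> _; exists a, 0; split; rewrite ?ltry ?addr0.
have [U xU Uf] := lf x b bf; have [V xV Vg] := lg x c cg.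
exists (U `&` V); first exact: filterI.
move=> y [/Uf fy /Vg gy]; apply: (@le_lt_trans _ _ (b%:E + c%:E)%E).
  by rewrite -EFinD lee_fin.
exact: lteD.
Qed.

Lemma lscZ (c : R) f : 0 < c -> lower_semicontinuous f ->
  lower_semicontinuous (fun x => c%:E * f x)%E.
Proof.
move=> c0 lf x a; rewrite -lte_pdivrMl// => /lf[U xU Uf].
by exists U => // y /Uf; rewrite -lte_pdivrMl.
Qed.

Lemma lsc_EFin (h : X -> R) : continuous h ->
  lower_semicontinuous (fun x => (h x)%:E).
Proof.
move=> ch x a; rewrite lte_fin => ahx.
exists [set y | a < h y]; last by move=> y; rewrite lte_fin.
by apply: (ch x [set r | a < r]); apply: open_nbhs_nbhs; split => //; exact: open_gt.
Qed.

Lemma lsc_sum (k : nat) (f : 'I_k -> X -> \bar R) :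
  (forall j, lower_semicontinuous (f j)) ->
  lower_semicontinuous (fun x => \sum_(j < k) f j x)%E.
Proof.
elim: k f => [|k IH] f lf.
  have -> : (fun x => \sum_(j < 0) f j x)%E = (fun x : X => (0 : R)%:E).
    by apply/funext => x; rewrite big_ord0.
  by apply: lsc_EFin => x; exact: cst_continuous.
have -> : (fun x => \sum_(j < k.+1) f j x)%E =
    (fun x => \sum_(j < k) f (widen_ord (leqnSn k) j) x + f ord_max x)%E.
  by apply/funext => x; rewrite big_ord_recr.
by apply: lscD => //; apply: IH.
Qed.

End lsc.

Lemma lsc_comp (R : realType) (X Y : topologicalType) (h : X -> Y)
    (f : Y -> \bar R) : continuous h -> lower_semicontinuous f ->
  lower_semicontinuous (f \o h).
Proof.
move=> ch lf x a /lf[U xU Uf]; exists (h @^-1` U); first exact: ch.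
by move=> y /Uf.
Qed.

(** * The limiting normal cone *)

Section normal_cone.
Context {R : realType} {N : nat}.
Implicit Types (Om : set 'rV[R]_N) (x v : 'rV[R]_N).

(** The sequences of the definition replaced by approximations up to any given
    error. *)
Lemma normal_coneP Om x v : normal_cone Om x v <->
  [/\ closed Om, Om x & forall e, 0 < e -> exists (y w : 'rV[R]_N) (a : R),
    [/\ `|x - y| < e, proj_set Om y w, 0 <= a & `|v - a *: (y - w)| < e]].
Proof.
split=> [[cO Ox [y [w [a [yx pw a0 av]]]]]|[cO Ox H]].
  split=> // e e0.
  have [k _ Hk] : \forall k \near \oo, `|x - y k| < e /\
      `|v - a k *: (y k - w k)| < e.
    by apply: filterI; [move/cvgrPdist_lt: yx; apply|move/cvgrPdist_lt: av; apply].
  by exists (y k), (w k), (a k); have [] := Hk k (leqnn k).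
split=> //.
have Hk k := H k.+1%:R^-1 (ltac:(by rewrite invr_gt0)).
have /choice[y /choice[w /choice[a Ha]]] := Hk.
exists y, w, a; split => //.
- apply/cvgrPdist_lt => e e0; have := near_infty_natSinv_lt (PosNum e0).
  by apply: filterS => k; apply: lt_trans; have [] := Ha k.
- by move=> k; have [] := Ha k.
- by move=> k; have [] := Ha k.
- apply/cvgrPdist_lt => e e0; have := near_infty_natSinv_lt (PosNum e0).
  by apply: filterS => k; apply: lt_trans; have [] := Ha k.
Qed.

(** The graph of the limiting normal cone is closed: the cone consists of limits
    of proximal normals, so a diagonal argument applies. *)
Lemma closed_normal_cone Om : closed Om ->
  closed [set p : 'rV[R]_N * 'rV[R]_N | normal_cone Om p.1 p.2].
Proof.
move=> cO -[x v] cl /=; apply/normal_coneP; split=> //.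
  apply: cO => B xB.
  have [|[p1 p2] [/= /normal_coneP[_ Op _] Bp]] := cl (fst @^-1` B).
    exact: (cvg_fst xB).
  by exists p1.
move=> e e0; have e2 : 0 < e / 2 by rewrite divr_gt0.
have [|[p1 p2] [/= /normal_coneP[_ _ H] [/= xp vp]]] := cl (ball (x, v) (e / 2)).
  exact: nbhsx_ballx.
have [y [w [a [py pw a0 pv]]]] := H _ e2.
exists y, w, a; split => //.
- rewrite -(subrKA p1) (le_lt_trans (ler_normD _ _))// (splitr e) ltrD//.
  by move: xp; rewrite -ball_normE.
- rewrite -(subrKA p2) (le_lt_trans (ler_normD _ _))// (splitr e) ltrD//.
  by move: vp; rewrite -ball_normE.
Qed.

Lemma closed_shift Om u : closed Om -> closed [set x + u | x in Om].
Proof.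
move=> cO.
have -> : [set x + u | x in Om] = (fun x => x - u) @^-1` Om.
  apply/seteqP; split=> [_ [x Ox <-]|x /= Ox]; first by rewrite /= addrK.
  by exists (x - u) => //; rewrite subrK.
apply: preimage_closed => // x _.
by apply: (@continuousB _ _ _ (fun y => y) (fun=> u)) => //; exact: cst_continuous.
Qed.

(** The normal cone to a translated set: in particular the cone to [C + u] at [x]
    depends only on [x - u]. *)
Lemma normal_cone_shift Om u x v :
  normal_cone [set y + u | y in Om] (x + u) v <-> normal_cone Om x v.
Proof.
have shiftK (A : set 'rV[R]_N) t : [set y + - t | y in [set y + t | y in A]] = A.
  apply/seteqP; split=> [_ [_ [y Ay <-] <-]|y Ay]; first by rewrite addrK.
  by exists (y + t); [exists y|rewrite addrK].
have imp (A : set 'rV[R]_N) (t z : 'rV[R]_N) :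
    normal_cone A z v -> normal_cone [set y + t | y in A] (z + t) v.
  move=> /normal_coneP[cA Az H]; apply/normal_coneP; split.
  - exact: closed_shift.
  - by exists z.
  - move=> e /H[y [w [a [zy [Aw pw] a0 va]]]].
    have sh (p q : 'rV[R]_N) : p + t - (q + t) = p - q by rewrite opprD addrACA subrr addr0.
    exists (y + t), (w + t), a; rewrite !sh; split => //; split; first by exists w.
    by move=> _ [w' Aw' <-]; rewrite !sh; exact: pw.
split; last exact: imp.
by move=> /imp -/(_ (- u)); rewrite shiftK addrK.
Qed.

End normal_cone.

(** * Locally integrable and locally square integrable functions *)

Section interval_integrals.
Context {R : realType}.
Local Notation mu := (@lebesgue_measure R).
Implicit Types (f g : R -> R) (a b c : R).

(** Measurable functions on the line, integrable on each segment. *)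
Definition locint f := measurable_fun setT f /\
  forall a b, mu.-integrable `[a, b] (EFin \o f).

(** Measurable functions on the line, square integrable on each segment. *)
Definition L2loc f := measurable_fun setT f /\ locint (fun t => f t ^+ 2).

(** The integral of [f] over the segment from [a] to [b]; it is used for [a <= b]
    only, the segment being empty otherwise. *)
Definition itg f a b : R := \int[mu]_(t in `[a, b]) f t.

Lemma locint_le f g : measurable_fun setT f -> locint g ->
  (forall t, `|f t| <= g t) -> locint f.
Proof.
move=> mf [mg ig] fg; split=> // a b.
apply: (@le_integrable _ _ _ mu _ _ _ (EFin \o g)) => //.
  by apply/measurable_EFinP; exact: measurable_funTS.
by move=> t _; rewrite /= lee_fin (le_trans (fg t))// ler_norm.
Qed.

Lemma locintD f g : locint f -> locint g -> locint (fun t => f t + g t).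
Proof.
move=> [mf lf] [mg lg]; split; first exact: measurable_funD.
move=> a b; have : mu.-integrable `[a, b] ((EFin \o f) \+ (EFin \o g))%E.
  by apply: integrableD.
by apply: eq_integrable.
Qed.

Lemma locintZ k f : locint f -> locint (fun t => k * f t).
Proof.
move=> [mf lf]; split; first exact: measurable_funM.
move=> a b; have : mu.-integrable `[a, b] (fun x => k%:E * (EFin \o f) x)%E.
  by apply: integrableZl.
by apply: eq_integrable.
Qed.

Lemma locintB f g : locint f -> locint g -> locint (fun t => f t - g t).
Proof.
move=> lf /(locintZ (-1)) lg; have := locintD lf lg.
by congr locint; apply/funext => t; rewrite mulN1r.
Qed.

Lemma continuous_locint f : continuous f -> locint f.
Proof.
move=> cf; split; first exact: continuous_measurable_fun.
move=> a b; apply: continuous_compact_integrable; first exact: segment_compact.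
exact: continuous_subspaceT.
Qed.

Lemma locint_cst k : locint (fun=> k).
Proof. by apply: continuous_locint => t; exact: cst_continuous. Qed.

Lemma L2locD f g : L2loc f -> L2loc g -> L2loc (fun t => f t + g t).
Proof.
move=> [mf lf] [mg lg]; split; first exact: measurable_funD.
apply: (@locint_le _ (fun t => 2 * f t ^+ 2 + 2 * g t ^+ 2)).
- by apply: measurable_funX; exact: measurable_funD.
- by apply: locintD; exact: locintZ.
- by move=> t; rewrite ger0_norm ?sqr_ge0//; have := sqr_ge0 (f t - g t); nra.
Qed.

Lemma L2locZ k f : L2loc f -> L2loc (fun t => k * f t).
Proof.
move=> [mf lf]; split; first exact: measurable_funM.
have := locintZ (k ^+ 2) lf.
by congr locint; apply/funext => t; rewrite exprMn.
Qed.

Lemma L2locB f g : L2loc f -> L2loc g -> L2loc (fun t => f t - g t).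
Proof.
move=> lf /(L2locZ (-1)) lg; have := L2locD lf lg.
by congr L2loc; apply/funext => t; rewrite mulN1r.
Qed.

Lemma continuous_L2loc f : continuous f -> L2loc f.
Proof.
move=> cf; split; first exact: continuous_measurable_fun.
by apply: continuous_locint => t; apply: (@continuousM _ _ f f); exact: cf.
Qed.

Lemma L2loc_cst k : L2loc (fun=> k).
Proof. by apply: continuous_L2loc => t; exact: cst_continuous. Qed.

Lemma L2loc_sqr f : L2loc f -> locint (fun t => f t ^+ 2).
Proof. by case. Qed.

Lemma L2loc_locint f : L2loc f -> locint f.
Proof.
move=> [mf lf]; apply: (@locint_le _ (fun t => 1 + f t ^+ 2)) => //.
  by apply: locintD => //; exact: locint_cst.
by move=> t; rewrite -real_normK ?num_real//; have := normr_ge0 (f t); nra.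
Qed.

Lemma locint_sum (I : Type) (r : seq I) (F : I -> R -> R) :
  (forall i, locint (F i)) -> locint (fun t => \sum_(i <- r) F i t).
Proof.
move=> lF; elim: r => [|i r IH].
  by under eq_fun do rewrite big_nil; exact: locint_cst.
by under eq_fun do rewrite big_cons; exact: locintD.
Qed.

Lemma itgD f g a b : locint f -> locint g ->
  itg (fun t => f t + g t) a b = itg f a b + itg g a b.
Proof. by move=> [_ lf] [_ lg]; rewrite /itg RintegralD. Qed.

Lemma itgZ k f a b : locint f -> itg (fun t => k * f t) a b = k * itg f a b.
Proof. by move=> [_ lf]; rewrite /itg RintegralZl. Qed.

Lemma itgB f g a b : locint f -> locint g ->
  itg (fun t => f t - g t) a b = itg f a b - itg g a b.
Proof. by move=> [_ lf] [_ lg]; rewrite /itg RintegralB. Qed.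

Lemma itg_cst k a b : a <= b -> itg (fun=> k) a b = (b - a) * k.
Proof.
move=> ab; rewrite /itg Rintegral_cst//= lebesgue_measure_itv/= lte_fin mulrC.
by move: ab; rewrite le_eqVlt => /orP[/eqP ->|->]; rewrite ?ltxx ?subrr.
Qed.

Lemma itg_sum (I : Type) (r : seq I) (F : I -> R -> R) a b : a <= b ->
  (forall i, locint (F i)) ->
  itg (fun t => \sum_(i <- r) F i t) a b = \sum_(i <- r) itg (F i) a b.
Proof.
move=> ab lF; elim: r => [|i r IH].
  by under eq_fun do rewrite big_nil; rewrite big_nil itg_cst// mulr0.
under eq_fun do rewrite big_cons; rewrite big_cons -IH itgD//.
exact: locint_sum.
Qed.

Lemma itg_ge0 f a b : (forall t, 0 <= f t) -> 0 <= itg f a b.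
Proof. by move=> f0; apply: Rintegral_ge0. Qed.

Lemma le_itg f g a b : locint f -> locint g ->
  (forall t, t \in `[a, b] -> f t <= g t) -> itg f a b <= itg g a b.
Proof. by move=> [_ lf] [_ lg] fg; apply: le_Rintegral. Qed.

Lemma itg_cat f a b c : locint f -> a <= b -> b <= c ->
  itg f a c = itg f a b + itg f b c.
Proof.
move=> [_ lf] ab bc; have := @Rintegral_itvB R f (BLeft a) (BRight c) b (lf a c).
rewrite !bnd_simp => /(_ ab bc) H; rewrite /itg -(@Rintegral_itv_obnd_cbnd _ b).
  by rewrite -H addrC subrK.
by apply: integrableS (lf b c) => //; apply: subset_itvr; rewrite bnd_simp.
Qed.

Lemma itg_sub f a b c d : locint f -> (forall t, 0 <= f t) ->
  a <= b -> b <= c -> c <= d -> itg f b c <= itg f a d.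
Proof.
move=> lf f0 ab bc cd; rewrite (itg_cat lf ab (le_trans bc cd)) (itg_cat lf bc cd).
by have := itg_ge0 a b f0; have := itg_ge0 c d f0; lra.
Qed.

Lemma sum_itg f (t : nat -> R) k : locint f -> (forall j, t j <= t j.+1) ->
  \sum_(j < k) itg f (t j) (t j.+1) = itg f (t 0%N) (t k).
Proof.
move=> lf tS; elim: k => [|k IH].
  by rewrite big_ord0 /itg set_itv1 Rintegral_set1.
rewrite big_ord_recr/= IH -itg_cat//.
by elim: k {IH} => // k /le_trans; apply.
Qed.

(** The Cauchy-Schwarz inequality against the constant 1. *)
Lemma itg_sqr_le f a b : L2loc f -> a <= b ->
  itg f a b ^+ 2 <= (b - a) * itg (fun t => f t ^+ 2) a b.
Proof.
move=> lf ab0; have /predU1P[->|ab] : (a == b) || (a < b) by rewrite -le_eqVlt.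
  by rewrite /itg set_itv1 Rintegral_set1 expr0n subrr mul0r.
have h0 : 0 < b - a by rewrite subr_gt0.
set I := itg f a b; set c := I / (b - a).
have [l1 l2] := (L2loc_locint lf, lf.2).
have l3 : locint (fun t => 2 * c * f t) by exact: locintZ.
(* the integral of [(f - c)^2], where [c] is the mean of [f] *)
have H : 0 <= itg (fun t => f t ^+ 2) a b - 2 * c * I + (b - a) * c ^+ 2.
  rewrite -(itg_cst _ ab0) -(itgZ _ _ _ l1) -itgB// -itgD//; last 2 first.
  - exact: locintB.
  - exact: locint_cst.
  by apply: itg_ge0 => t; have := sqr_ge0 (f t - c); nra.
have cI : (b - a) * c = I by rewrite /c mulrC divfK// gt_eqF.
have := mulr_ge0 (ltW h0) H.
have -> : (b - a) * (itg (fun t => f t ^+ 2) a b - 2 * c * I + (b - a) * c ^+ 2) =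
    (b - a) * itg (fun t => f t ^+ 2) a b - I ^+ 2 by rewrite -cI; ring.
by rewrite subr_ge0.
Qed.

(** Young's inequality [|f| <= (k + f^2 / k) / 2], integrated: a form of the
    Cauchy-Schwarz inequality without square roots, which can be summed over the
    mesh intervals with one weight [k]. *)
Lemma normr_itg_le f a b k : L2loc f -> a <= b -> 0 < k ->
  `|itg f a b| <= ((b - a) * k + itg (fun t => f t ^+ 2) a b / k) / 2.
Proof.
move=> lf ab k0; have [l1 l2] := (L2loc_locint lf, lf.2).
have : itg (fun t => `|f t|) a b <= itg (fun t => (k + f t ^+ 2 * k^-1) / 2) a b.
  apply: le_itg.
  - apply: (@locint_le _ (fun t => 1 + f t ^+ 2)).
    + by apply: measurableT_comp => //; case: lf.
    + by apply: locintD => //; exact: locint_cst.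
    + by move=> t; rewrite normr_id -real_normK ?num_real//; have := normr_ge0 (f t); nra.
  - have := locintZ 2^-1 (locintD (locint_cst k) (locintZ k^-1 l2)).
    by congr locint; apply/funext => t; rewrite mulrC [k^-1 * _]mulrC.
  - move=> t _; rewrite -real_normK ?num_real//.
    rewrite -(ler_pM2r k0) -subr_ge0.
    have -> : (k + `|f t| ^+ 2 / k) / 2 * k - `|f t| * k = (k - `|f t|) ^+ 2 / 2.
      by field; rewrite gt_eqF.
    by rewrite divr_ge0 ?sqr_ge0.
move=> H; apply: (le_trans (le_normr_Rintegral _ _) (le_trans H _)) => //.
  by case: l1.
under eq_fun do rewrite mulrC [_ / k]mulrC.
rewrite itgZ ?itgD ?itgZ ?itg_cst//; last 3 first.
- exact: locint_cst.
- exact: locintZ.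
- by apply: locintD; [exact: locint_cst|exact: locintZ].
by rewrite mulrC [k^-1 * _]mulrC.
Qed.

Lemma ge0_integral_translate (F : R -> \bar R) a b (s : R) :
  measurable_fun setT F -> (forall t, 0 <= F t)%E ->
  (\int[mu]_(t in `[a, b]) F (t + s)%R =
   \int[mu]_(t in `[(a + s)%R, (b + s)%R]) F t)%E.
Proof.
move=> mF F0.
pose phi : measurableTypeR R -> measurableTypeR R := fun t : R => t + s.
have mphi : measurable_fun setT phi.
  by apply: measurable_funD => //; exact: measurable_cst.
have := @ge0_integral_pushforward _ _ _ _ R phi mphi mu `[a + s, b + s] F
  (measurable_itv _) (measurable_funTS mF) (fun t _ => F0 t).
have -> : phi @^-1` `[a + s, b + s] = `[a, b]%classic.
  by apply/seteqP; split=> t /=; rewrite !in_itv/= !lerD2r.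
move=> <-; apply/esym; apply: eq_measure_integral => A mA _.
apply: (@lebesgue_measure_unique R (pushforward mu phi)) => //.
move=> _ [[c d] _ <-]/=; rewrite /pushforward.
have -> : phi @^-1` `]c, d] = `]c - s, d - s]%classic.
  by apply/seteqP; split=> t /=; rewrite !in_itv/= ltrBlDr lerBrDr.
rewrite !lebesgue_measure_itv/= !lte_fin ltrD2r; case: ifP => // _.
by rewrite -!EFinB; congr EFin; ring.
Qed.

End interval_integrals.

(** * Sampling of square integrable functions *)

Section sampling.
Context {R : realType}.
Local Notation mu := (@lebesgue_measure R).
Implicit Types (f g : R -> R) (a b c : R).

(** Heine's theorem. *)
Lemma segment_unif_continuous f a b e : continuous f -> 0 < e ->
  exists2 d, 0 < d & forall s t, s \in `[a, b] -> t \in `[a, b] ->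
    `|s - t| <= d -> `|f s - f t| <= e.
Proof.
move=> cf e0.
have e2 : 0 < e / 2 by rewrite divr_gt0.
have := (compact_near_coveringP _).1 (@segment_compact R a b) R (0^'+)
  (fun d t => forall s, `|s - t| <= d -> `|f s - f t| <= e) _.
case.
  move=> t _; have /cvgrPdist_lt/(_ _ e2)[r /= r0 Hr] := cf t.
  exists ([set x | `|t - x| < r / 2], [set d | d < r / 2]).
    split=> /=.
      by exists (r / 2) => //=; rewrite divr_gt0.
    by apply: nbhs_right_lt; rewrite divr_gt0.
  move=> [x d] [/= tx dr] s sx.
  have fx : `|f t - f x| < e / 2 by apply: Hr; rewrite /ball_/=; lra.
  have fs : `|f t - f s| < e / 2.
    apply: Hr; rewrite /ball_/=.
    rewrite -(subrKA x) (le_lt_trans (ler_normD _ _))//.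
    by rewrite (distrC x s); lra.
  rewrite -(subrKA (f t)) (le_trans (ler_normD _ _))// (distrC (f s)); lra.
move=> r /= r0 H.
exists (r / 2); first by rewrite divr_gt0.
move=> s t _ tab; apply: (H (r / 2)) => //.
- by rewrite /= sub0r normrN gtr0_norm ?divr_gt0//; lra.
- by rewrite divr_gt0.
Qed.

(** The truncation of [x] to the interval from [- M] to [M]; in this form its
    continuity in [x] is evident. *)
Let clip (M x : R) := (`|x + M| - `|x - M|) / 2.

Let clip_continuous M : continuous (clip M).
Proof.
move=> x; apply: (@continuousM _ _ (fun x => `|x + M| - `|x - M|) (fun=> 2^-1));
  last exact: cst_continuous.
apply: continuousB; apply: continuous_comp; try exact: norm_continuous.
  by apply: continuousD => //; exact: cst_continuous.
by apply: continuousB => //; exact: cst_continuous.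
Qed.

Let clip_id M x : `|x| <= M -> clip M x = x.
Proof.
rewrite ler_norml => /andP[Mx xM]; rewrite /clip ger0_norm ?ler0_norm; lra.
Qed.

Let clip_bound M x : 0 <= M -> `|clip M x| <= M.
Proof.
move=> M0; rewrite ler_norml /clip.
by case: (ger0P (x + M)); case: (ger0P (x - M)) => *; apply/andP; split; lra.
Qed.

Let clip_lip M x y : 0 <= M -> `|clip M x - clip M y| <= `|x - y|.
Proof.
move=> M0; rewrite /clip.
case: (ger0P (x + M)); case: (ger0P (x - M));
case: (ger0P (y + M)); case: (ger0P (y - M)); case: (ger0P (x - y)) => *;
rewrite ler_norml; apply/andP; split; lra.
Qed.

Let clip_err M x : 0 <= M -> (x - clip M x) ^+ 2 <= x ^+ 2.
Proof.
move=> M0; rewrite -(real_normK (num_real x)) -(real_normK (num_real (x - _))).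
rewrite ler_sqr ?nnegrE// /clip.
case: (ger0P (x + M)); case: (ger0P (x - M)); case: (ger0P x) => *;
rewrite ler_norml; apply/andP; split; lra.
Qed.

(** Continuous functions are dense in [L^2] of a segment. The function is first
    truncated at a large level [M], which changes it little in [L^2] by dominated
    convergence; the truncation is then approximated by a continuous function in
    [L^1], which suffices since both may be taken bounded by [M]. *)
Lemma L2_approx f a b eta : L2loc f -> 0 < eta ->
  exists2 g, continuous g & itg (fun t => (f t - g t) ^+ 2) a b <= eta.
Proof.
move=> lf e0.
have mclip M : measurable_fun setT (fun t => clip M (f t)).
  apply: measurableT_comp; last by case: lf.
  by apply: continuous_measurable_fun; exact: clip_continuous.
have lclip M : 0 <= M -> L2loc (fun t => f t - clip M (f t)).
  move=> M0; split; first by apply: measurable_funB => //; case: lf.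
  apply: (@locint_le _ _ (fun t => f t ^+ 2)) => //.
  - by apply: measurable_funX; apply: measurable_funB => //; case: lf.
  - by case: lf.
  - by move=> t; rewrite ger0_norm ?sqr_ge0// clip_err.
have [n Hn] : exists n : nat,
    itg (fun t => (f t - clip n%:R (f t)) ^+ 2) a b <= eta / 4.
  have [||||||_ _] := @dominated_convergence _ _ R mu `[a, b] _
    (fun n t => ((f t - clip n%:R (f t)) ^+ 2)%:E) (fun=> 0%E)
    (fun t => (f t ^+ 2)%:E).
  - by [].
  - move=> n; apply/measurable_EFinP; apply: measurable_funTS.
    by have [_ [m _]] := lclip n%:R (ler0n _ _).
  - exact: measurable_cst.
  - apply: aeW => t _; apply: cvg_near_cst.
    have := nbhs_infty_ger (`|f t|); apply: filterS => n nt.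
    by rewrite clip_id// subrr expr0n.
  - by case: lf => _ [_ H]; exact: H.
  - apply: aeW => t n _; rewrite lee_fin ger0_norm ?sqr_ge0//.
    exact: clip_err.
  rewrite integral0 => /fine_cvgP[_ /cvgrPdist_lt/(_ (eta / 4))].
  case; first by rewrite divr_gt0.
  move=> n _ /(_ n (leqnn n))/=; rewrite sub0r normrN => H.
  by exists n; rewrite (le_trans (ler_norm _))// ltW.
set M : R := n%:R in Hn.
have M0 : 0 <= M by exact: ler0n.
have e1 : 0 < eta / (8 * (M + 1)) by rewrite divr_gt0// mulr_gt0//; lra.
have lc : locint (fun t => clip M (f t)).
  apply: (@locint_le _ _ (fun=> M)) => //; first exact: locint_cst.
  by move=> t; exact: clip_bound.
have [g [cg Hg]] : exists g, continuous g /\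
    itg (fun t => `|clip M (f t) - g t|) a b <= eta / (8 * (M + 1)).
  have [||g [cg _]] := @approximation_continuous_integrable R `[a, b]
    (fun t => clip M (f t)) (measurable_itv _).
  - rewrite /= lebesgue_measure_itv/=; case: ifP => // _.
    by rewrite -EFinB ltry.
  - by case: lc => _; exact.
  move=> /fine_cvgP[_ /cvgrPdist_lt/(_ _ e1)[m _ /(_ m (leqnn m))/=]].
  rewrite sub0r normrN => H.
  by exists (g m); split => //; rewrite (le_trans (ler_norm _))// ltW.
exists (fun t => clip M (g t)).
  by move=> t; apply: continuous_comp; [exact: cg|exact: clip_continuous].
have l2 : locint (fun t => `|clip M (f t) - g t|).
  have [ml ll] := locintB lc (continuous_locint cg).
  split; first exact: measurableT_comp.
  by move=> u w; exact: integrable_norm.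
have l1 : locint (fun t => (f t - clip M (f t)) ^+ 2) by have [] := lclip _ M0.
apply: (@le_trans _ _ (itg (fun t => 2 * (f t - clip M (f t)) ^+ 2 +
    (4 * M) * `|clip M (f t) - g t|) a b)).
  apply: le_itg.
  - have [] : L2loc (fun t => f t - clip M (g t)) => //.
    apply: L2locB => //; apply: continuous_L2loc => t.
    by apply: continuous_comp; [exact: cg|exact: clip_continuous].
  - by apply: locintD; exact: locintZ.
  - move=> t _.
    have h1 := clip_bound (f t) M0; have h2 := clip_bound (g t) M0.
    have h3 : `|clip M (f t) - clip M (g t)| <= `|clip M (f t) - g t|.
      by rewrite -[X in `|X - _|](@clip_id M)//; exact: clip_lip.
    set p := f t - clip M (f t).
    set q := clip M (f t) - clip M (g t).
    have -> : f t - clip M (g t) = p + q by rewrite /p /q; ring.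
    have qM : `|q| <= 2 * M.
      by rewrite (le_trans (ler_normB _ _))//; lra.
    have : q ^+ 2 <= 2 * M * `|clip M (f t) - g t|.
      by rewrite -real_normK ?num_real// expr2 ler_pM.
    by have := sqr_ge0 (p - q); nra.
rewrite itgD ?itgZ//; try exact: locintZ.
have : 4 * M * itg (fun t => `|clip M (f t) - g t|) a b <= eta / 2.
  apply: (@le_trans _ _ (4 * (M + 1) * (eta / (8 * (M + 1))))).
    apply: ler_pM => //; first by lra.
    - by apply: itg_ge0 => t; exact: normr_ge0.
    - by lra.
  rewrite le_eqVlt; apply/orP; left; apply/eqP; field; lra.
lra.
Qed.

(** An averaging argument: the integral over the offset [th] of the Riemann sum
    of [E] at the points [j h - h + th] is the integral of [E]; hence some offset
    makes [h] times this sum at most twice a given positive bound [eta] of the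
    integral, and it can be chosen so that the points avoid the null set [Z]. *)
Lemma select_offset (E : R -> R) (Z : set R) (h eta : R) (k : nat) :
  0 < h -> locint E -> (forall t, 0 <= E t) -> measurable Z -> mu Z = 0%E ->
  0 < eta -> itg E (- h) (k%:R * h - h) <= eta ->
  exists th, [/\ 0 <= th <= h,
    h * \sum_(j < k) E (j%:R * h - h + th) <= 2 * eta &
    forall j, (j < k)%N -> ~ Z (j%:R * h - h + th)].
Proof.
move=> h0 lE E0 mZ Z0 e0 Ee.
(* [F] equals [E] almost everywhere; a finite sum of its values avoids [Z] *)
pose F t := if t \in Z then +oo%E else (E t)%:E.
have F0 t : (0 <= F t)%E by rewrite /F; case: ifP => _; rewrite ?lee_fin ?leey.
have mF : measurable_fun setT F.
  apply: measurable_fun_ifT.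
  - have -> : (fun t => t \in Z) = (fun t => (\1_Z t : R) == 1).
      by apply/funext => t; rewrite indicE; case: (t \in Z); rewrite ?eqxx// eq_sym oner_eq0.
    apply: measurable_fun_eqr => //; exact: measurable_indic.
  - exact: measurable_cst.
  - by apply/measurable_EFinP; case: lE.
have intF a b : (\int[mu]_(t in `[a, b]) F t = (itg E a b)%:E)%E.
  transitivity (\int[mu]_(t in `[a, b]) (E t)%:E)%E.
    apply: ge0_ae_eq_integral => //.
    - exact: measurable_funTS.
    - by apply/measurable_EFinP; apply: measurable_funTS; case: lE.
    - by move=> t _; rewrite lee_fin.
    - exists Z; split => // t /= /not_implyP[_ Ft].
      apply: contrapT => nZ; apply: Ft; rewrite /F ifF//.
      by apply/negbTE; rewrite notin_setE.
  by rewrite /itg /Rintegral fineK//; apply: integrable_fin_num => //; case: lE.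
apply: contrapT => /forallNP H.
have lb th : th \in `[0, h] ->
    ((2 * eta / h)%:E <= \sum_(j < k) F (j%:R * h - h + th)%R)%E.
  rewrite in_itv/= => th0h; rewrite leNgt; apply/negP => lt.
  have nZ (j : 'I_k) : (j%:R * h - h + th) \notin Z.
    apply/negP => jZ; move: lt; rewrite (bigD1 j)//= /F jZ addye ?ltNge ?leey//.
    apply/eqP => e; have : (0 <= -oo :> \bar R)%E; last by [].
    by rewrite -e; apply: sume_ge0 => i _; exact: F0.
  apply: (H th); split => //.
  - move: lt; under eq_bigr do rewrite /F (negbTE (nZ _)).
    rewrite sumEFin lte_fin ltr_pdivlMr// => /ltW.
    by rewrite mulrC.
  - by move=> j jk; have := nZ (Ordinal jk); rewrite notin_setE.
have mFs (j : 'I_k) : measurable_fun setT (fun th => F (j%:R * h - h + th)).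
  by apply: measurableT_comp => //; apply: measurable_funD => //; exact: measurable_cst.
have : (\int[mu]_(th in `[0%R, h]) (2 * eta / h)%:E <=
        \int[mu]_(th in `[0%R, h]) \sum_(j < k) F (j%:R * h - h + th)%R)%E.
  apply: ge0_le_integral => //.
  - by move=> t _; rewrite lee_fin divr_ge0 ?mulr_ge0// ltW.
  - apply: emeasurable_sum => j; exact: (measurable_funTS (mFs j)).
rewrite ge0_integral_sum//; last first.
  by move=> j; exact: (measurable_funTS (mFs j)).
under eq_bigr => j _.
  under eq_integral do rewrite addrC.
  rewrite (ge0_integral_translate _ _ _ mF F0) intF add0r.
  over.
rewrite sumEFin integral_cst//= lebesgue_measure_itv/= lte_fin h0 oppr0 adde0.
rewrite -EFinM lee_fin divfK ?gt_eqF//.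
have -> : \sum_(j < k) itg E (j%:R * h - h) (h + (j%:R * h - h)) =
    itg E (- h) (k%:R * h - h).
  have := @sum_itg R E (fun j => j%:R * h - h) k lE.
  rewrite mul0r sub0r => <-.
    apply: eq_bigr => j _; congr itg; rewrite -natr1; ring.
  by move=> j; rewrite -natr1 mulrDl; lra.
by move=> /le_trans/(_ Ee); lra.
Qed.

End sampling.

(** The [j]-th sample time of the uniform mesh of step [h] shifted by an offset
    [th] in [[0, h]]: it lies in the mesh interval that precedes [j * h], so that
    the sample number [0] is taken at a nonpositive time. *)
Definition sample_time (R : realType) (h th : R) (j : nat) : R := j%:R * h - h + th.

Section offset_sampling.
Context {R : realType}.
Local Notation mu := (@lebesgue_measure R).

Let sqr3 (x y z : R) : (x + y + z) ^+ 2 <= 3 * (x ^+ 2 + y ^+ 2 + z ^+ 2).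
Proof.
have := sqr_ge0 (x - y); have := sqr_ge0 (y - z); have := sqr_ge0 (x - z); nra.
Qed.

Let itg3 (f e : R -> R) (A w h : R) (a b : R) : a <= b -> h = b - a -> L2loc f -> L2loc e ->
  (forall t, t \in `[a, b] -> (f t) ^+ 2 <= 3 * (w + A + (e t) ^+ 2)) ->
  itg (fun t => f t ^+ 2) a b <=
  3 * (h * (w + A) + itg (fun t => e t ^+ 2) a b).
Proof.
move=> ab -> lf le H.
have lc := @locint_cst R (w + A).
rewrite -itg_cst// -itgD//; last by case: le.
rewrite -itgZ; last by apply: locintD => //; case: le.
apply: le_itg => //; first by case: lf.
by apply: locintZ; apply: locintD => //; case: le.
Qed.

(** One offset serves all mesh intervals and all coordinates: along a fine mesh,
    the values of [v] at the sample times, and its means between consecutive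
    sample times, both approximate [v] in mean square, and the sample times avoid
    a given null set. *)
Lemma sampling (N : nat) (v : 'I_N -> R -> R) (T eta : R) (Z : set R) :
  0 < T -> (forall i, L2loc (v i)) -> measurable Z -> mu Z = 0%E -> 0 < eta ->
  \forall k \near \oo, exists th, [/\ 0 <= th <= T / k%:R,
    forall j, (j <= k)%N -> ~ Z (sample_time (T / k%:R) th j),
    forall i, \sum_(j < k)
      itg (fun t => (v i (sample_time (T / k%:R) th j) - v i t) ^+ 2)
        (j%:R * (T / k%:R)) (j.+1%:R * (T / k%:R)) <= eta &
    forall i, \sum_(j < k)
      itg (fun t => ((T / k%:R)^-1 * itg (v i) (sample_time (T / k%:R) th j)
                       (sample_time (T / k%:R) th j.+1) - v i t) ^+ 2)
        (j%:R * (T / k%:R)) (j.+1%:R * (T / k%:R)) <= eta].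
Proof.
move=> T0 lv mZ Z0 eta0.
have N1 : 0 < N.+1%:R :> R by rewrite ltr0n.
(* with their factor 3, the three error terms are at most [eta / 2] for the
   oscillation of the continuous approximations, [eta / 3] for their errors at
   the sample times, doubled by the averaging argument, and [eta / 6] for their
   mean square errors *)
set e1 := eta / 18 / N.+1%:R.
have e10 : 0 < e1 by rewrite !divr_gt0.
have /choice[c Hc] : forall i, exists c : R -> R, continuous c /\
    itg (fun t => (v i t - c t) ^+ 2) (- T) T <= e1.
  by move=> i; have [c cc ?] := L2_approx (- T) T (lv i) e10; exists c.
have cc i : continuous (c i) by case: (Hc i).
set w := Num.sqrt (eta / (6 * T)).
have w0 : 0 < w by rewrite sqrtr_gt0 divr_gt0// mulr_gt0.
have w2 : w ^+ 2 = eta / (6 * T) by rewrite sqr_sqrtr// ltW// divr_gt0// mulr_gt0.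
have /choice[d Hd] : forall i, exists d, 0 < d /\
    forall s t, s \in `[- T, T] -> t \in `[- T, T] ->
    `|s - t| <= d -> `|c i s - c i t| <= w.
  by move=> i; have [d d0 ?] := segment_unif_continuous (- T) T (cc i) w0; exists d.
pose e i t := v i t - c i t.
have le i : L2loc (e i) by apply: L2locB => //; exact: continuous_L2loc.
(* one offset for all coordinates: average the sum of the squared errors *)
pose E t := \sum_(i < N) e i t ^+ 2.
have lE : locint E by apply: locint_sum => i; case: (le i).
have E0 t : 0 <= E t by apply: sumr_ge0 => i _; exact: sqr_ge0.
have IE : itg E (- T) T <= eta / 18.
  rewrite itg_sum//; [|by lra|by move=> i; case: (le i)].
  apply: (@le_trans _ _ (\sum_(i < N) e1)).
    by apply: ler_sum => i _; case: (Hc i).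
  rewrite sumr_const card_ord -[e1 *+ _]mulr_natr /e1 mulrAC ler_pdivrMr//.
  by rewrite ler_pM2l ?divr_gt0// ler_nat.
have Ie i : itg (fun t => e i t ^+ 2) (- T) T <= eta / 18.
  apply: le_trans IE; apply: le_itg => //; first by case: (le i).
  move=> t _; rewrite /E (bigD1 i)//= lerDl.
  by apply: sumr_ge0 => j _; exact: sqr_ge0.
have Hk i : \forall k \near \oo, 2 * T / d i <= k%:R by exact: nbhs_infty_ger.
have := @filter_forall nat 'I_N _ eventually _ Hk.
move=> Hk'; near=> k; set h := T / k%:R.
have hE : h = T / k%:R by [].
have k0 : 0 < k%:R :> R by rewrite ltr0n; near: k; exact: nbhs_infty_gt.
have h0 : 0 < h by rewrite hE divr_gt0.
have kh : k%:R * h = T by rewrite hE mulrC divfK// gt_eqF.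
have hT : h <= T.
  rewrite -kh ler_peMl ?(ltW h0)// ler1n -(ltr0n R) //.
have hd i : 2 * h <= d i.
  have : 2 * T / d i <= k%:R by move: i; near: k; exact: Hk'.
  have [d0 _] := Hd i.
  by rewrite ler_pdivrMr// -kh => H; rewrite -(ler_pM2l k0); lra.
have [th [/andP[th0 thh] S1 S2]] : exists th, [/\ 0 <= th <= h,
    h * \sum_(j < k) E (j%:R * h - h + th) <= 2 * (eta / 18) &
    forall j, (j <= k)%N -> ~ Z (j%:R * h - h + th)].
  have [||th [th0h S1 S2]] := @select_offset R E Z h (eta / 18) k.+1 h0 lE E0 mZ Z0.
  - by rewrite divr_gt0.
  - by apply: le_trans IE; apply: itg_sub => //; rewrite -?natr1; lra.
  - exists th; split => //; apply: le_trans S1.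
    by rewrite ler_pM2l// big_ord_recr/= lerDl.
exists th; rewrite /sample_time; split => //; first by rewrite th0.
- move=> i.
  have jb (j : 'I_k) : 0 <= j%:R * h /\ j%:R * h + h <= T.
    split; first by rewrite mulr_ge0// ltW.
    by rewrite -kh -[X in _ + X <= _]mul1r -mulrDl natr1 ler_pM2r// ler_nat.
  have step (j : 'I_k) : itg (fun t => (v i (j%:R * h - h + th) - v i t) ^+ 2)
      (j%:R * h) (j.+1%:R * h) <=
      3 * (h * (w ^+ 2 + E (j%:R * h - h + th)) +
        itg (fun t => e i t ^+ 2) (j%:R * h) (j.+1%:R * h)).
    have [j1 j2] := jb j.
    have hj : h = j.+1%:R * h - j%:R * h by rewrite -natr1; ring.
    apply: itg3 => //; first by lra.
      by apply: L2locB => //; exact: L2loc_cst.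
    move=> t; rewrite in_itv/= -natr1 mulrDl mul1r => /andP[t1 t2].
    set s := j%:R * h - h + th.
    have cw : `|c i s - c i t| <= w.
      have [_ H] := Hd i; apply: H; rewrite ?in_itv/=.
      - by apply/andP; split; rewrite /s; lra.
      - by apply/andP; split; lra.
      - by rewrite (le_trans _ (hd i))// ler_norml /s; apply/andP; split; lra.
    have -> : v i s - v i t = (c i s - c i t) + e i s - e i t by rewrite /e; ring.
    apply: (le_trans (sqr3 _ _ _)); rewrite ler_pM2l// sqrrN.
    apply: lerD => //; apply: lerD.
      by rewrite -[X in X <= _]real_normK ?num_real// ler_sqr ?nnegrE// ltW.
    rewrite /E (bigD1 i)//= lerDl.
    by apply: sumr_ge0 => ? _; exact: sqr_ge0.
  apply: (le_trans (ler_sum _ (fun j _ => step j))).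
  rewrite -mulr_sumr big_split/= -mulr_sumr big_split/=.
  rewrite (@sum_itg _ _ (fun j => j%:R * h)) ?mul0r//; last 2 first.
  - by case: (le i).
  - by move=> j; rewrite ler_pM2r// ler_nat.
  rewrite sumr_const card_ord -[_ *+ k]mulr_natl.
  have : itg (fun t => e i t ^+ 2) 0 (k%:R * h) <= eta / 18.
    apply: le_trans (Ie i); apply: itg_sub; rewrite ?kh//; [by case: (le i)| |lra|lra].
    by move=> t; exact: sqr_ge0.
  have : w ^+ 2 * k%:R * h = eta / 6.
    by rewrite -mulrA kh w2; field; rewrite gt_eqF.
  move: S1; lra.
- move=> i.
  have jb (j : 'I_k) : 0 <= j%:R * h /\ j%:R * h + h <= T.
    split; first by rewrite mulr_ge0// ltW.
    by rewrite -kh -[X in _ + X <= _]mul1r -mulrDl natr1 ler_pM2r// ler_nat.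
  set tau' := fun j => j%:R * h - h + th.
  have step (j : 'I_k) :
      itg (fun t => (h^-1 * itg (v i) (tau' j) (tau' j.+1) - v i t) ^+ 2)
      (j%:R * h) (j.+1%:R * h) <=
      3 * (h * (w ^+ 2 + h^-1 * itg (fun t => e i t ^+ 2) (tau' j) (tau' j.+1)) +
        itg (fun t => e i t ^+ 2) (j%:R * h) (j.+1%:R * h)).
    have [j1 j2] := jb j.
    have hj : h = j.+1%:R * h - j%:R * h by rewrite -natr1; ring.
    have tj : tau' j.+1 = tau' j + h by rewrite /tau' -natr1; ring.
    have tjh : tau' j.+1 - tau' j = h by rewrite tj; ring.
    have tjle : tau' j <= tau' j.+1 by lra.
    apply: itg3 => //; first by lra.
      by apply: L2locB => //; exact: L2loc_cst.
    move=> t; rewrite in_itv/= => /andP[t1]; rewrite -natr1 mulrDl mul1r => t2.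
    have vE : itg (v i) (tau' j) (tau' j.+1) =
        itg (c i) (tau' j) (tau' j.+1) + itg (e i) (tau' j) (tau' j.+1).
      rewrite -itgD; [|exact: continuous_locint|exact: L2loc_locint].
      by congr itg; apply/funext => s; rewrite /e; ring.
    have cw : `|h^-1 * itg (c i) (tau' j) (tau' j.+1) - c i t| <= w.
      have cst s : s \in `[tau' j, tau' j.+1] -> `|c i s - c i t| <= w.
        rewrite in_itv/= => /andP[s1 s2].
        have [_ H] := Hd i; apply: H; rewrite ?in_itv/=.
        - by move: s1 s2; rewrite tj /tau' => s1 s2; apply/andP; split; lra.
        - by apply/andP; split; lra.
        - rewrite (le_trans _ (hd i))// ler_norml; move: s1 s2; rewrite tj /tau' => s1 s2.
          by apply/andP; split; lra.
      have lc := continuous_locint (cc i).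
      have up : itg (c i) (tau' j) (tau' j.+1) <= h * (c i t + w).
        rewrite -tjh -itg_cst//; apply: le_itg => //; first exact: locint_cst.
        by move=> s /cst; rewrite ler_norml => /andP[_]; lra.
      have lo : h * (c i t - w) <= itg (c i) (tau' j) (tau' j.+1).
        rewrite -tjh -itg_cst//; apply: le_itg => //; first exact: locint_cst.
        by move=> s /cst; rewrite ler_norml => /andP[+ _]; lra.
      rewrite -(ler_pM2l h0) -[h in h * `|_|]gtr0_norm// -normrM.
      rewrite mulrBr mulrA mulfV ?gt_eqF// mul1r ler_norml.
      by apply/andP; split; lra.
    have ce : (h^-1 * itg (e i) (tau' j) (tau' j.+1)) ^+ 2 <=
        h^-1 * itg (fun t => e i t ^+ 2) (tau' j) (tau' j.+1).
      rewrite -(ler_pM2l (exprn_gt0 2 h0)).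
      set I := itg (e i) _ _; set I2 := itg _ _ _.
      have -> : h ^+ 2 * (h^-1 * I) ^+ 2 = I ^+ 2 by field; rewrite gt_eqF.
      have -> : h ^+ 2 * (h^-1 * I2) = h * I2 by field; rewrite gt_eqF.
      by have := itg_sqr_le (le i) tjle; rewrite tjh.
    have -> : h^-1 * itg (v i) (tau' j) (tau' j.+1) - v i t =
      (h^-1 * itg (c i) (tau' j) (tau' j.+1) - c i t) +
      h^-1 * itg (e i) (tau' j) (tau' j.+1) - e i t by rewrite vE /e; ring.
    apply: (le_trans (sqr3 _ _ _)); rewrite ler_pM2l// sqrrN.
    apply: lerD => //; apply: lerD => //.
    by rewrite -[X in X <= _]real_normK ?num_real// ler_sqr ?nnegrE// ltW.
  apply: (le_trans (ler_sum _ (fun j _ => step j))).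
  rewrite -mulr_sumr big_split/= -mulr_sumr big_split/= sumr_const card_ord.
  rewrite -[_ *+ k]mulr_natl -mulr_sumr.
  rewrite (@sum_itg _ _ (fun j => j%:R * h)) ?mul0r//; last 2 first.
  - by case: (le i).
  - by move=> j; rewrite ler_pM2r// ler_nat.
  rewrite (@sum_itg _ _ tau'); last 2 first.
  - by case: (le i).
  - by move=> j; rewrite /tau' -natr1; lra.
  rewrite [h * (_ + _)]mulrDr [h * (h^-1 * _)]mulrA mulfV ?gt_eqF// mul1r.
  have : itg (fun t => e i t ^+ 2) 0 (k%:R * h) <= eta / 18.
    apply: le_trans (Ie i); apply: itg_sub; rewrite ?kh//; [by case: (le i)| |lra|lra].
    by move=> t; exact: sqr_ge0.
  have : itg (fun t => e i t ^+ 2) (tau' 0%N) (tau' k) <= eta / 18.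
    apply: le_trans (Ie i); apply: itg_sub; rewrite /tau' ?mul0r ?kh//;
      [by case: (le i)| |lra|lra|lra].
    by move=> t; exact: sqr_ge0.
  have : w ^+ 2 * k%:R * h = eta / 6.
    by rewrite -mulrA kh w2; field; rewrite gt_eqF.
  lra.
Unshelve. all: by end_near. Qed.

End offset_sampling.

(** * Integrands equal almost everywhere and the space W^{1,2} *)

Section ae_integral.
Context d (X : measurableType d) (R : realType).
Variable mu : {measure set X -> \bar R}.
Local Open Scope ereal_scope.

(** Monotonicity of the integral without any measurability. *)
Lemma ge0_integral_mono (D : set X) (f g : X -> \bar R) :
  (forall x, D x -> 0 <= f x <= g x) ->
  \int[mu]_(x in D) f x <= \int[mu]_(x in D) g x.
Proof.
move=> fg; rewrite !ge0_integralE.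
- apply: ereal_sup_le => _ [h /= hf <-]; exists h => //= x.
  apply: (le_trans (hf x)); rewrite /patch; case: ifP => //.
  by rewrite inE => /fg/andP[].
- by move=> x /fg/andP[f0]; apply: le_trans.
- by move=> x /fg/andP[f0].
Qed.

(** The integrand [f] need not be measurable, only its almost everywhere equal
    [g]: so the derivative of a curve of class W^{1,2}, which has no prescribed
    value on a null set, may be replaced by a density. *)
Lemma ge0_ae_integral (D : set X) (f g : X -> \bar R) :
  measurable D -> measurable_fun D g ->
  (forall x, D x -> 0 <= f x) -> (forall x, D x -> 0 <= g x) ->
  {ae mu, forall x, D x -> f x = g x} ->
  \int[mu]_(x in D) f x = \int[mu]_(x in D) g x.
Proof.
move=> mD mg f0 g0 [Z [mZ Z0 DZ]].
have fgZ x : D x -> ~ Z x -> f x = g x.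
  by move=> Dx nZ; apply: contrapT => fg; apply: nZ; apply: DZ => /= /(_ Dx).
have mZb : measurable_fun D (fun x => x \in Z).
  have -> : (fun t => t \in Z) = (fun t => (\1_Z t : R) == 1%R).
    by apply/funext => t; rewrite indicE; case: (t \in Z); rewrite ?eqxx// eq_sym oner_eq0.
  apply: measurable_fun_eqr => //; exact: measurable_indic.
(* [f] lies between [lo] and [up], which agree with [g] off the null set *)
pose lo x := if x \in Z then 0 else g x.
pose up x := if x \in Z then +oo else g x.
have mlo : measurable_fun D lo.
  by apply: measurable_fun_if => //; apply: measurable_funS mg => //; exact: subIsetl.
have mup : measurable_fun D up.
  by apply: measurable_fun_if => //; apply: measurable_funS mg => //; exact: subIsetl.
have lo0 x : D x -> 0 <= lo x by move=> Dx; rewrite /lo; case: ifP => // _; exact: g0.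
have up0 x : D x -> 0 <= up x.
  by move=> Dx; rewrite /up; case: ifP => // _; exact: g0.
have nZb x : (x \in Z) = false -> ~ Z x by move=> h; rewrite -notin_setE h.
apply/eqP; rewrite eq_le; apply/andP; split.
- apply: (@le_trans _ _ (\int[mu]_(x in D) up x)).
    apply: ge0_integral_mono => x Dx; rewrite f0//= /up.
    by case: ifPn => [_|/negbTE/nZb nZ]; rewrite ?leey// fgZ.
  rewrite le_eqVlt; apply/orP; left; apply/eqP.
  apply: ge0_ae_eq_integral => //; exists Z; split => // x /= /not_implyP[Dx ux].
  apply: contrapT => nZ; apply: ux; rewrite /up ifF//.
  by apply/negbTE; rewrite notin_setE.
- apply: (@le_trans _ _ (\int[mu]_(x in D) lo x)).
    rewrite le_eqVlt; apply/orP; left; apply/eqP.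
    apply: ge0_ae_eq_integral => //; exists Z; split => // x /= /not_implyP[Dx ux].
    apply: contrapT => nZ; apply: ux; rewrite /lo ifF//.
    by apply/negbTE; rewrite notin_setE.
  apply: ge0_integral_mono => x Dx; rewrite lo0//= /lo.
  by case: ifPn => [_|/negbTE/nZb nZ]; rewrite ?f0// fgZ.
Qed.

End ae_integral.

Section W12.
Context {R : realType}.
Local Notation mu := (@lebesgue_measure R).

(** A curve of class W^{1,2} is the primitive of a density [v], locally square
    integrable on the line and equal almost everywhere on [[0, T]] to the
    derivative of the curve. The density vanishes on the negative half-line, as if
    the curve had been extended by a constant. *)
Lemma W12_density (T : R) (N : nat) (z : R -> 'rV[R]_N) : 0 < T -> W12 T z ->
  exists v : 'I_N -> R -> R,
  [/\ forall i, L2loc (v i),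
      forall i t, t <= 0 -> v i t = 0,
      forall i t, t \in `[0, T] -> z t 0 i = z 0 0 i + itg (v i) 0 t &
      {ae mu, forall t, t \in `[0, T] -> forall i, derive1 z t 0 i = v i t}].
Proof.
move=> T0 [V HV].
pose v i := (fun t => V t 0 i) \_ `]0, T].
have sub0T : `]0, T] `<=` (`[0, T] : set R).
  by move=> t /=; rewrite !in_itv/= => /andP[/ltW-> ->].
have mv i : measurable_fun setT (v i).
  apply/(measurable_restrictT _ _).1 => //; have [mV _ _] := HV i.
  exact: measurable_funS mV.
have lv i : L2loc (v i).
  split=> //; split; first exact: measurable_funX.
  move=> a b; apply: (@integrableS _ _ _ mu setT) => //.
  have [_ H _] := HV i; have E : EFin \o (fun t => v i t ^+ 2) =
      (fun t => ((V t 0 i) ^+ 2)%:E) \_ `]0, T].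
    by apply/funext => t; rewrite /v /patch /=; case: ifP => //; rewrite expr0n.
  by rewrite E -integrable_mkcond//; apply: integrableS H.
have zv i t : t \in `[0, T] -> z t 0 i = z 0 0 i + itg (v i) 0 t.
  move=> tT; have [_ _ ->//] := HV i; congr (_ + _).
  have [mV _ _] := HV i.
  have sub : `]0, t] `<=` (`[0, T] : set R).
    move=> s /=; rewrite !in_itv/= => /andP[/ltW-> st]; rewrite (le_trans st)//.
    by move: tT; rewrite in_itv/= => /andP[].
  rewrite /itg /Rintegral -!integral_itv_obnd_cbnd; last 2 first.
  - by apply/measurable_EFinP; exact: measurable_funTS.
  - by apply/measurable_EFinP; exact: measurable_funS mV.
  congr fine; apply: eq_integral => s; rewrite inE/= in_itv/= => /andP[s0 st].
  rewrite /v patchE mem_set//= in_itv/= s0 (le_trans st)//.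
  by move: tT; rewrite in_itv/= => /andP[].
exists v; split => //.
  move=> i t t0; rewrite /v patchE ifF//; apply/negbTE; rewrite notin_setE/=.
  by rewrite in_itv/= ltNge t0.
(* the Lebesgue differentiation theorem, in each coordinate *)
have ftc i : {ae mu, forall x, 0 < x ->
    derivable (fun y => itg (v i) 0 y) x 1 /\ derive1 (fun y => itg (v i) 0 y) x = v i x}.
  have [_ li] := L2loc_locint (lv i).
  suff loc : locally_integrable setT (v i).
    have := @FTC1 R (v i) (BLeft 0) (fun y => li 0 y) loc.
    apply: filterS; first exact: (ae_filter_ringOfSetsType mu).
    by move=> x H x0; apply: H; rewrite /= lte_fin.
  split; [exact: mv|exact: openT|].
  move=> K _ cK; have [M [_ HM]] := compact_bounded cK.
  have ln : mu.-integrable `[- (M + 1), M + 1] (EFin \o (fun t => `|v i t|)).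
    exact: integrable_norm.
  have /integrableP[_] := li (- (M + 1)) (M + 1).
  apply: le_lt_trans; apply: ge0_subset_integral => //.
  - exact: compact_measurable.
  - exact: (measurable_int mu ln).
  - by move=> x Kx /=; rewrite in_itv/= -ler_norml; apply: HM => //; rewrite ltrDl.
have ne x : {ae mu, forall t : R, t != x}.
  exists [set x]; split => //; first exact: lebesgue_measure_set1.
  by move=> t /= /negP; rewrite negbK => /eqP.
have aeF : Filter (nbhs (almost_everywhere mu)) by exact: (ae_filter_ringOfSetsType mu).
have ftc' := @filter_forall _ 'I_N _ _ aeF ftc.
have := @filterI _ _ aeF _ _ (@filterI _ _ aeF _ _ (ne 0) (ne T)) ftc'.
apply: (@filterS _ _ aeF) => t [[t0 tT] H] tI i.
have {}t0T : 0 < t < T.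
  move: tI; rewrite in_itv/= => /andP[].
  by rewrite le_eqVlt eq_sym (negbTE t0)/= => ->; rewrite le_eqVlt (negbTE tT).
have zE j : \forall s \near t, (z 0 0 j + itg (v j) 0 s) = z s 0 j.
  near=> s.
  have : s \in `]0, T[ by near: s; apply: near_in_itvoo; rewrite in_itv/=.
  by rewrite in_itv/= => /andP[s0 sT]; rewrite (zv j s)// in_itv/= !ltW.
have dz j : derivable (fun s => z s 0 j) t 1 /\ derive1 (fun s => z s 0 j) t = v j t.
  have [|D1 D2] := H j; first by case/andP: t0T.
  have D1' : derivable (fun s => z 0 0 j + itg (v j) 0 s) t 1.
    by apply: derivableD => //; exact: derivable_cst.
  split; first exact: near_eq_derivable (zE j) D1'.
  rewrite -D2 !derive1E -(near_eq_derive _ (zE j)) deriveD//=.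
  by rewrite derive_cst add0r.
have dzt : derivable z t 1.
  by apply/derivable_mxP => a j; rewrite ord1; case: (dz j).
by rewrite derive1E derive_mx// mxE -derive1E; case: (dz i).
Unshelve. all: by end_near. Qed.

End W12.

(* The maximum norm [`|v|] is used for estimates; it is equivalent to the
   Euclidean norm. *)
Section norms.
Context {R : realType} {N : nat}.
Implicit Types v w : 'rV[R]_N.

Lemma rV_normP v (e : R) : 0 <= e -> (forall i, `|v 0 i| <= e) -> `|v| <= e.
Proof.
move=> e0 H; rewrite [leLHS]mx_normrE; apply: bigmax_le => // -[a i] _ /=.
by rewrite ord1.
Qed.

Lemma rV_coord_le v i : `|v 0 i| <= `|v|.
Proof.
rewrite [leRHS]mx_normrE.
exact: (@le_bigmax _ _ _ 0 (fun ij : 'I_1 * 'I_N => `|v ij.1 ij.2|) (0, i)).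
Qed.

Lemma dotp_ge0 v : 0 <= dotp v v.
Proof. by apply: sumr_ge0 => i _; rewrite -expr2 sqr_ge0. Qed.

Lemma enorm_sqr v : enorm v ^+ 2 = \sum_(i < N) v 0 i ^+ 2.
Proof. by rewrite /enorm sqr_sqrtr ?dotp_ge0//; apply: eq_bigr => i _; rewrite expr2. Qed.

Lemma enorm_ge0 v : 0 <= enorm v.
Proof. exact: sqrtr_ge0. Qed.

Lemma norm_le_enorm v : `|v| <= enorm v.
Proof.
apply: rV_normP; first exact: enorm_ge0.
move=> i; rewrite -ler_sqr ?nnegrE ?enorm_ge0// enorm_sqr.
rewrite real_normK ?num_real// (bigD1 i)//= lerDl.
by apply: sumr_ge0 => j _; exact: sqr_ge0.
Qed.

Lemma enorm_le_norm v : enorm v <= N.+1%:R * `|v|.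
Proof.
have c0 : 0 <= N.+1%:R * `|v| by rewrite mulr_ge0.
rewrite -ler_sqr ?nnegrE ?enorm_ge0// enorm_sqr exprMn.
apply: (@le_trans _ _ (\sum_(i < N) `|v| ^+ 2)).
  apply: ler_sum => i _; rewrite -[leLHS]real_normK ?num_real//.
  by rewrite ler_sqr ?nnegrE//; exact: rV_coord_le.
rewrite sumr_const card_ord -[_ *+ N]mulr_natl ler_wpM2r ?sqr_ge0//.
by rewrite -natrX ler_nat (leq_trans (leqnSn N))// -{1}[N.+1]expn1 leq_pexp2l.
Qed.

End norms.

Section W12_facts.
Context {R : realType}.
Local Notation mu := (@lebesgue_measure R).
Variables (T : R) (N : nat) (z : R -> 'rV[R]_N) (v : 'I_N -> R -> R).
Hypothesis T0 : 0 < T.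
Hypothesis lv : forall i, L2loc (v i).
Hypothesis v0 : forall i t, t <= 0 -> v i t = 0.
Hypothesis zv : forall i t, t \in `[0, T] -> z t 0 i = z 0 0 i + itg (v i) 0 t.
Hypothesis dz : {ae mu, forall t, t \in `[0, T] -> forall i, derive1 z t 0 i = v i t}.

Let itg_neg i s t : s <= t -> t <= 0 -> itg (v i) s t = 0.
Proof.
move=> st t0; rewrite -[RHS](mulr0 (t - s)) -(itg_cst _ st).
apply: eq_Rintegral => x; rewrite inE/= in_itv/= => /andP[_ xt].
by rewrite v0// (le_trans xt).
Qed.

(** The increments of the curve extended by the constant [z 0] to negative
    times. *)
Lemma primitive_incr i s t : s <= t -> t <= T ->
  z (Num.max 0 t) 0 i - z (Num.max 0 s) 0 i = itg (v i) s t.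
Proof.
move=> st tT; have li := L2loc_locint (lv i).
have [t0|] := boolP (t <= 0).
  by rewrite !max_l ?(le_trans st t0)// subrr itg_neg.
rewrite -ltNge => t0; rewrite [Num.max 0 t]max_r ?ltW//.
have zt : z t 0 i = z 0 0 i + itg (v i) 0 t by apply: zv; rewrite in_itv/= ltW.
have [s0|] := boolP (s <= 0).
  rewrite max_l// (itg_cat li s0 (ltW t0)) itg_neg// zt; ring.
rewrite -ltNge => s0; rewrite max_r ?ltW//.
have zs : z s 0 i = z 0 0 i + itg (v i) 0 s.
  by apply: zv; rewrite in_itv/= ltW//= (le_trans st).
by rewrite zt zs (itg_cat li (ltW s0) st); ring.
Qed.

(** The extended curve is uniformly continuous. *)
Lemma primitive_modulus w : 0 < w -> exists2 d, 0 < d &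
  forall i s t, - T <= s -> s <= t -> t <= T -> t - s <= d ->
    `|z (Num.max 0 t) 0 i - z (Num.max 0 s) 0 i| <= w.
Proof.
move=> w0.
pose M := \sum_(i < N) itg (fun t => v i t ^+ 2) (- T) T.
have Mi i : itg (fun t => v i t ^+ 2) (- T) T <= M.
  rewrite /M (bigD1 i)//= lerDl; apply: sumr_ge0 => j _.
  by apply: itg_ge0 => t; exact: sqr_ge0.
have M0 : 0 <= M.
  by apply: sumr_ge0 => j _; apply: itg_ge0 => t; exact: sqr_ge0.
(* this weight makes both terms of Young's inequality at most [w] when
   [t - s <= w / k] *)
pose k := (M + 1) / w.
have k0 : 0 < k by rewrite divr_gt0//; lra.
exists (w / k); first by rewrite divr_gt0.
move=> i s t Ts st tT ts; rewrite primitive_incr//.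
apply: (le_trans (normr_itg_le (lv i) st k0)).
have : (t - s) * k <= w by rewrite -ler_pdivlMr.
have : itg (fun t => v i t ^+ 2) s t / k <= w.
  rewrite ler_pdivrMr// /k mulrCA divff ?gt_eqF// mulr1.
  have : itg (fun t => v i t ^+ 2) s t <= itg (fun t => v i t ^+ 2) (- T) T.
    by apply: itg_sub => //; [case: (lv i)|move=> x; exact: sqr_ge0].
  by have := Mi i; lra.
lra.
Qed.

Lemma primitive_bounded : exists2 B, 0 <= B & forall t, t \in `[0, T] -> `|z t| <= B.
Proof.
pose M := \sum_(i < N) itg (fun t => v i t ^+ 2) 0 T.
have M0 : 0 <= M.
  by apply: sumr_ge0 => j _; apply: itg_ge0 => t; exact: sqr_ge0.
have B0 : 0 <= `|z 0| + (T + M) by rewrite !addr_ge0// ltW.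
exists (`|z 0| + (T + M)) => // t tT; apply: rV_normP => // i.
have : t \in `[0, T] by []; rewrite in_itv/= => /andP[t0 tT'].
rewrite zv// (le_trans (ler_normD _ _))// lerD ?rV_coord_le//.
apply: (le_trans (normr_itg_le (lv i) t0 ltr01)).
have : itg (fun t => v i t ^+ 2) 0 t <= M.
  rewrite /M (bigD1 i)//= -[X in X <= _]addr0; apply: lerD.
    by apply: itg_sub => //; [case: (lv i)|move=> x; exact: sqr_ge0].
  by apply: sumr_ge0 => j _; apply: itg_ge0 => x; exact: sqr_ge0.
have := T0; lra.
Qed.

(** The integral of the squared distance of the velocity to a constant, in terms
    of the densities of the coordinates. *)
Lemma integral_gap (q : 'rV[R]_N) a b : 0 <= a -> a <= b -> b <= T ->
  (\int[mu]_(t in `[a, b]) ((enorm (q - derive1 z t)) ^+ 2)%:E =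
   (\sum_(i < N) itg (fun t => (q 0 i - v i t) ^+ 2) a b)%:E)%E.
Proof.
move=> a0 ab bT.
have lq i : locint (fun t => (q 0 i - v i t) ^+ 2).
  by have [] : L2loc (fun t => q 0 i - v i t) by apply: L2locB => //; exact: L2loc_cst.
have ls : locint (fun t => \sum_(i < N) (q 0 i - v i t) ^+ 2).
  exact: locint_sum.
rewrite -itg_sum// /itg /Rintegral fineK; last first.
  by apply: integrable_fin_num => //; case: ls.
apply: ge0_ae_integral => //.
- by case: ls => _ H; exact: (measurable_int mu (H a b)).
- by move=> t _; rewrite lee_fin sqr_ge0.
- by move=> t _; rewrite lee_fin; apply: sumr_ge0 => i _; exact: sqr_ge0.
- have aeF : Filter (nbhs (almost_everywhere mu)) by exact: (ae_filter_ringOfSetsType mu).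
  apply: (@filterS _ _ aeF) dz => t H; rewrite /= in_itv/= => /andP[ta tb].
  rewrite enorm_sqr; congr EFin; apply: eq_bigr => i _.
  rewrite !mxE H// in_itv/= (le_trans a0 ta)/=.
  exact: le_trans bT.
Qed.

(** Indeed this is a quadratic polynomial in [q]. *)
Lemma continuous_itg_sqr i a b : a <= b ->
  continuous (fun q : R => itg (fun t => (q - v i t) ^+ 2) a b).
Proof.
move=> ab.
have -> : (fun q : R => itg (fun t => (q - v i t) ^+ 2) a b) =
  (fun q => (b - a) * q ^+ 2 - 2 * q * itg (v i) a b + itg (fun t => v i t ^+ 2) a b).
  apply/funext => q.
  have l1 := L2loc_locint (lv i); have l2 := L2loc_sqr (lv i).
  rewrite -(itg_cst _ ab) -(itgZ _ _ _ l1) -itgB; last 2 first.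
  - exact: locint_cst.
  - exact: locintZ.
  rewrite -itgD//; last by apply: locintB; [exact: locint_cst|exact: locintZ].
  by congr itg; apply/funext => t; ring.
move=> q; apply: cvgD; last exact: cvg_cst.
apply: cvgB.
  by apply: cvgM; [exact: cvg_cst|exact: exprn_continuous].
apply: cvgM; last exact: cvg_cst.
by apply: cvgM; [exact: cvg_cst|exact: cvg_id].
Qed.

End W12_facts.

(** * Stability of the explicit Euler scheme *)

(** The scheme [x, y] is compared with a reference sequence [X, Y]. The states
    [xs, ys] at which the reference dynamics are sampled differ from the reference
    by at most [w], the slopes [DX, DY] reproduce its increments up to [delta], and
    the fields [fa], [fb] are [L]-Lipschitz on the ball of radius [r], which
    contains the 1-neighbourhood of the reference states. The scheme is the one
    obtained from a differential inclusion when the normal vector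
    [- (DX j + fa j (xs j) + ys j)] of the sampled dynamics is kept and the fields
    are evaluated at the current state. *)
Section euler.
Context {R : realType} {n : nat}.
Local Notation V := 'rV[R]_n.
Variables (k : nat) (h T L r eta w : R).
Variables (x y xs ys X Y DX DY : nat -> V) (fa fb : nat -> V -> V).
Variable delta : nat -> R.
Hypotheses (h0 : 0 < h) (h1 : h <= 1) (kh : k%:R * h = T) (L0 : 0 <= L)
  (w0 : 0 <= w).
Hypothesis lipa : forall j p q, (j < k)%N -> `|p| <= r -> `|q| <= r ->
  `|fa j p - fa j q| <= L * `|p - q|.
Hypothesis lipb : forall j p q, (j < k)%N -> `|p| <= r -> `|q| <= r ->
  `|fb j p - fb j q| <= L * `|p - q|.
Hypotheses (x0 : x 0%N = X 0%N) (y0 : y 0%N = Y 0%N).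
Hypothesis xS : forall j, (j < k)%N -> x j.+1 =
  x j + h *: (DX j + fa j (xs j) + ys j - fa j (x j) - y j.+1).
Hypothesis yS : forall j, (j < k)%N -> y j.+1 = y j + h *: fb j (x j).
Hypothesis DYE : forall j, (j < k)%N -> DY j = fb j (xs j).
Hypothesis xsX : forall j, (j < k)%N -> `|xs j - X j| <= w.
Hypothesis ysY : forall j, (j < k)%N -> `|ys j - Y j.+1| <= w.
Hypothesis Xr : forall j, (j < k)%N -> `|X j| <= r - 1.
Hypothesis xsr : forall j, (j < k)%N -> `|xs j| <= r.
Hypothesis DXd : forall j, (j < k)%N ->
  `|h *: DX j - (X j.+1 - X j)| + `|h *: DY j - (Y j.+1 - Y j)| <= delta j.
Hypothesis small :
  expR ((3 * L + 1) * T) * (2 * \sum_(j < k) delta j + (3 * L + 1) * T * w) <= eta.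
Hypothesis eta1 : eta <= 1.

(* the error, which is at most [eta <= 1] as long as the estimate holds; this
   keeps [x j] in the ball where the fields are Lipschitz *)
Let e j := `|x j - X j| + `|y j - Y j|.

Let xr j : (j < k)%N -> e j <= eta -> `|x j| <= r.
Proof.
move=> jk ej; rewrite -(subrK (X j) (x j)) (le_trans (ler_normD _ _))//.
by have := eta1; have := Xr jk; have := normr_ge0 (y j - Y j); rewrite /e in ej; lra.
Qed.

Let lip_xs (f : nat -> V -> V) j :
  (forall j p q, (j < k)%N -> `|p| <= r -> `|q| <= r ->
    `|f j p - f j q| <= L * `|p - q|) ->
  (j < k)%N -> e j <= eta -> `|f j (xs j) - f j (x j)| <= L * (`|x j - X j| + w).
Proof.
move=> lf jk ej; apply: (le_trans (lf _ _ _ jk (xsr jk) (xr jk ej))).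
apply: ler_wpM2l => //; rewrite -(subrKA (X j)).
by rewrite (le_trans (ler_normD _ _))// addrC (distrC (X j)) lerD2l xsX.
Qed.

Let ye j : (j < k)%N -> e j <= eta -> `|y j.+1 - Y j.+1| <= `|y j - Y j| +
  `|h *: DY j - (Y j.+1 - Y j)| + h * (L * (`|x j - X j| + w)).
Proof.
move=> jk ej; have H := lip_xs lipb jk ej.
have -> : y j.+1 - Y j.+1 = (y j - Y j) + (h *: DY j - (Y j.+1 - Y j)) +
    - (h *: (fb j (xs j) - fb j (x j))).
  by rewrite yS// DYE//; apply/rowP => i; rewrite !mxE; ring.
rewrite (le_trans (ler_normD _ _))// lerD//; first exact: ler_normD.
by rewrite normrN normrZ gtr0_norm// ler_pM2l.
Qed.

Let xe j : (j < k)%N -> e j <= eta -> `|x j.+1 - X j.+1| <= `|x j - X j| +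
  `|h *: DX j - (X j.+1 - X j)| + h * (L * (`|x j - X j| + w)) +
  h * (w + `|y j.+1 - Y j.+1|).
Proof.
move=> jk ej; have H := lip_xs lipa jk ej.
have -> : x j.+1 - X j.+1 = (x j - X j) + (h *: DX j - (X j.+1 - X j)) +
    h *: (fa j (xs j) - fa j (x j)) + h *: ((ys j - Y j.+1) - (y j.+1 - Y j.+1)).
  by rewrite xS//; apply/rowP => i; rewrite !mxE; ring.
rewrite (le_trans (ler_normD _ _))// lerD//.
  rewrite (le_trans (ler_normD _ _))// lerD//; first exact: ler_normD.
  by rewrite normrZ gtr0_norm// ler_pM2l.
rewrite normrZ gtr0_norm// ler_pM2l// (le_trans (ler_normB _ _))// lerD2r.
exact: ysY.
Qed.

(** The discrete Gronwall inequality, with growth factor [1 + h (3 L + 1)] per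
    step. *)
Lemma euler_stability j : (j <= k)%N ->
  `|x j - X j| + `|y j - Y j| <= eta.
Proof.
have d0 i : (i < k)%N -> 0 <= delta i.
  by move=> ik; apply: le_trans (DXd ik); rewrite addr_ge0.
have small' := small; set K := 3 * L + 1 in small'; have K0 : 0 <= K by have := L0; rewrite /K; lra.
(* [e j <= (1 + h K)^j A j], by induction on [j] *)
pose A j := 2 * \sum_(i < j) delta i + j%:R * (h * K * w).
have hKw : 0 <= h * K * w by rewrite !mulr_ge0// ltW.
have A0 i : (i <= k)%N -> 0 <= A i.
  move=> ik; apply: addr_ge0; last exact: mulr_ge0.
  apply: mulr_ge0 => //; apply: sumr_ge0 => l _; apply: d0; exact: leq_trans (ltn_ord l) ik.
have Ak i : (i <= k)%N -> A i <= A k.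
  move=> ik; rewrite /A lerD//; last by rewrite ler_wpM2r// ler_nat.
  rewrite ler_pM2l// -(big_mkord xpredT delta) -(big_mkord xpredT delta).
  rewrite (big_cat_nat _ ik)//= lerDl big_nat; apply: sumr_ge0 => l /andP[_ lk].
  exact: d0.
have E i : (i <= k)%N -> (1 + h * K) ^+ i * A i <= eta.
  move=> ik; apply: le_trans small'.
  have -> : 2 * \sum_(j < k) delta j + K * T * w = A k.
    by rewrite /A -kh; congr (_ + _); ring.
  apply: ler_pM; rewrite ?A0 ?Ak//.
    by rewrite exprn_ge0// addr_ge0// mulr_ge0// ltW.
  apply: (@le_trans _ _ (expR (h * K) ^+ i)).
    have b0 : 0 <= 1 + h * K by rewrite addr_ge0// mulr_ge0// ltW.
    by apply: lerXn2r; rewrite ?nnegrE ?expR_ge0//; exact: expR_ge1Dx.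
  rewrite -expRM_natl ler_expR -kh.
  have -> : K * (k%:R * h) = k%:R * (h * K) by ring.
  by apply: ler_wpM2r; [rewrite mulr_ge0// ltW|rewrite ler_nat].
suff H i : (i <= k)%N -> e i <= (1 + h * K) ^+ i * A i.
  by move=> jk; apply: le_trans (H _ jk) (E _ jk).
elim: i => [|i IH] ik.
  by rewrite /e x0 y0 !subrr !normr0 expr0 mul1r addr0 A0.
have {}IH := IH (ltnW ik).
have ei : e i <= eta := le_trans IH (E i (ltnW ik)).
have Hx := xe ik ei; have Hy := ye ik ei; have Hd := DXd ik.
have b1 : 1 <= 1 + h * K by rewrite lerDl mulr_ge0// ltW.
have step : e i.+1 <= (1 + h * K) * e i + (2 * delta i + h * K * w).
  rewrite /e; move: Hx Hy Hd.
  set ex' := `|x i.+1 - _|; set ey' := `|y i.+1 - _|.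
  set dx := `|h *: DX i - _|; set dy := `|h *: DY i - _|.
  set ex := `|x i - _|; set ey := `|y i - _| => Hx Hy Hd.
  have dx0 : 0 <= dx by exact: normr_ge0.
  have dy0 : 0 <= dy by exact: normr_ge0.
  have ex0 : 0 <= ex by exact: normr_ge0.
  have ey0 : 0 <= ey by exact: normr_ge0.
  have q0 : 0 <= L * (ex + w) by rewrite mulr_ge0// addr_ge0.
  have hh : h * (h * (L * (ex + w))) <= h * (L * (ex + w)).
    by rewrite ler_piMl// mulr_ge0// ltW.
  have hdy : h * dy <= dy by rewrite ler_piMl.
  have hy : h * ey' <= h * ey + h * dy + h * (h * (L * (ex + w))).
    by rewrite -!mulrDr ler_pM2l.
  have q1 : 0 <= h * (L * ey) by rewrite !mulr_ge0// ltW.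
  by move: (L0) (h0) (h1) (w0); rewrite /K; nra.
have -> : A i.+1 = A i + (2 * delta i + h * K * w).
  by rewrite /A big_ord_recr/= -natr1; ring.
have D0 : 0 <= 2 * delta i + h * K * w by rewrite addr_ge0// mulr_ge0// d0.
apply: (le_trans step); rewrite exprS [X in _ <= X]mulrDr; apply: lerD.
  rewrite -[_ * _ * A i]mulrA; apply: ler_wpM2l => //.
  exact: le_trans b1.
by rewrite ler_peMl// -exprS exprn_ege1.
Qed.

(** The slopes of the scheme are close to the prescribed slopes. *)
Lemma euler_velocity j : (j < k)%N ->
  `|h^-1 *: (x j.+1 - x j) - DX j| <= (L + 1) * (eta + w) /\
  `|h^-1 *: (y j.+1 - y j) - DY j| <= (L + 1) * (eta + w).
Proof.
move=> jk; have ej := euler_stability (ltnW jk); have ej1 := euler_stability jk.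
have n1 := normr_ge0 (x j - X j); have n2 := normr_ge0 (y j - Y j).
have n3 := normr_ge0 (x j.+1 - X j.+1); have n4 := normr_ge0 (y j.+1 - Y j.+1).
have Ha := lip_xs lipa jk ej; have Hb := lip_xs lipb jk ej.
have w0' := w0; have L0' := L0; have eta1' := eta1; have h0' := h0.
have hV : h^-1 * h = 1 by rewrite mulVf// gt_eqF.
have Le : L * (`|x j - X j| + w) <= L * (eta + w).
  by rewrite ler_wpM2l// lerD2r; lra.
split.
- rewrite xS// (addrC (x j)) addrK scalerA hV scale1r.
  have -> : DX j + fa j (xs j) + ys j - fa j (x j) - y j.+1 - DX j =
     (fa j (xs j) - fa j (x j)) + ((ys j - Y j.+1) - (y j.+1 - Y j.+1)).
    by apply/rowP => i; rewrite !mxE; ring.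
  have := ler_normD (fa j (xs j) - fa j (x j)) ((ys j - Y j.+1) - (y j.+1 - Y j.+1)).
  have := ler_normB (ys j - Y j.+1) (y j.+1 - Y j.+1).
  by have := ysY jk; lra.
- rewrite yS// (addrC (y j)) addrK scalerA hV scale1r DYE// distrC.
  have p0 : 0 <= eta + w by lra.
  lra.
Qed.

End euler.

(** * Block coordinates *)

Section blocks.
Context {R : realType} {n m d : nat}.
Local Notation N := (n + (n + (n + (m + d))))%N.

(** The coordinates of the five blocks x, y, u, a, b. *)
Definition ix (i : 'I_n) : 'I_N := lshift _ i.
Definition iy (i : 'I_n) : 'I_N := rshift n (lshift _ i).
Definition iu (i : 'I_n) : 'I_N := rshift n (rshift n (lshift _ i)).
Definition ia (i : 'I_m) : 'I_N := rshift n (rshift n (rshift n (lshift _ i))).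
Definition ib (i : 'I_d) : 'I_N := rshift n (rshift n (rshift n (rshift m i))).

Lemma block_ind (Q : 'I_N -> Prop) :
  (forall i, Q (ix i)) -> (forall i, Q (iy i)) -> (forall i, Q (iu i)) ->
  (forall i, Q (ia i)) -> (forall i, Q (ib i)) -> forall i, Q i.
Proof.
move=> Hx Hy Hu Ha Hb i.
case: (split_ordP i) => {}i ->; first exact: Hx.
case: (split_ordP i) => {}i ->; first exact: Hy.
case: (split_ordP i) => {}i ->; first exact: Hu.
by case: (split_ordP i) => {}i ->; [exact: Ha|exact: Hb].
Qed.

Implicit Type z : zvec R n m d.

Lemma zxE z i : zx z 0 i = z 0 (ix i). Proof. by rewrite !mxE. Qed.
Lemma zyE z i : zy z 0 i = z 0 (iy i). Proof. by rewrite !mxE. Qed.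
Lemma zuE z i : zu z 0 i = z 0 (iu i). Proof. by rewrite !mxE. Qed.
Lemma zaE z i : za z 0 i = z 0 (ia i). Proof. by rewrite !mxE. Qed.
Lemma zbE z i : zb z 0 i = z 0 (ib i). Proof. by rewrite !mxE. Qed.

(** The vector with the given five blocks. *)
Definition zcat (x y u : 'rV[R]_n) (a : 'rV[R]_m) (b : 'rV[R]_d) : zvec R n m d :=
  row_mx x (row_mx y (row_mx u (row_mx a b))).

Lemma zx_zcat x y u a b : zx (zcat x y u a b) = x.
Proof. by rewrite /zx /zcat row_mxKl. Qed.
Lemma zy_zcat x y u a b : zy (zcat x y u a b) = y.
Proof. by rewrite /zy /zcat row_mxKr row_mxKl. Qed.
Lemma zu_zcat x y u a b : zu (zcat x y u a b) = u.
Proof. by rewrite /zu /zcat !row_mxKr row_mxKl. Qed.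
Lemma za_zcat x y u a b : za (zcat x y u a b) = a.
Proof. by rewrite /za /zcat !row_mxKr row_mxKl. Qed.
Lemma zb_zcat x y u a b : zb (zcat x y u a b) = b.
Proof. by rewrite /zb /zcat !row_mxKr. Qed.

Lemma norm_zx z : `|zx z| <= `|z|.
Proof. by apply: rV_normP => // i; rewrite zxE; exact: rV_coord_le. Qed.

End blocks.

Section W12_blocks.
Context {R : realType} {n m d : nat} (T : R) (z : R -> zvec R n m d).
Hypothesis W : W12 T z.

Lemma W12_za : W12 T (fun t => za (z t)).
Proof.
case: W => V HV; exists (fun t => za (V t)) => i.
have [mV iV zV] := HV (ia i).
split.
- have -> : (fun t => za (V t) 0 i) = (fun t => V t 0 (ia i)) => //.
  by apply/funext => t; rewrite zaE.
- have -> : (fun t => (za (V t) 0 i ^+ 2)%:E) = (fun t => (V t 0 (ia i) ^+ 2)%:E) => //.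
  by apply/funext => t; rewrite zaE.
- move=> t tT; rewrite !zaE zV//; congr (_ + _).
  by apply: eq_Rintegral => s _; rewrite zaE.
Qed.

Lemma W12_zb : W12 T (fun t => zb (z t)).
Proof.
case: W => V HV; exists (fun t => zb (V t)) => i.
have [mV iV zV] := HV (ib i).
split.
- have -> : (fun t => zb (V t) 0 i) = (fun t => V t 0 (ib i)) => //.
  by apply/funext => t; rewrite zbE.
- have -> : (fun t => (zb (V t) 0 i ^+ 2)%:E) = (fun t => (V t 0 (ib i) ^+ 2)%:E) => //.
  by apply/funext => t; rewrite zbE.
- move=> t tT; rewrite !zbE zV//; congr (_ + _).
  by apply: eq_Rintegral => s _; rewrite zbE.
Qed.

End W12_blocks.

Section lipschitz.
Context {R : realType} {n m d s : nat}.
Variables (P : problem R n m d s) (z : R -> zvec R n m d).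
Local Notation T := (horizon P).

(** The Lipschitz condition along a curve, in terms of the maximum norm. *)
Lemma H2_lipschitz_norm r : H2_lipschitz P -> W12 T z -> 0 < r ->
  exists2 L, 0 <= L & forall t p q, t \in `[0, T] -> `|p| <= r -> `|q| <= r ->
    `|f1ax P (za (z t)) p - f1ax P (za (z t)) q| <= L * `|p - q| /\
    `|f2bx P (zb (z t)) p - f2bx P (zb (z t)) q| <= L * `|p - q|.
Proof.
move=> HL W r0.
have c0 : 0 < n.+1%:R :> R by rewrite ltr0n.
have cr0 : 0 < n.+1%:R * r by rewrite mulr_gt0.
have [L [L1 [L2 [L0 L10 _ H _]]]] := HL _ _ _ cr0 (W12_za W) (W12_zb W).
exists ((L + L1) * n.+1%:R); first by rewrite mulr_ge0// addr_ge0.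
have toE p : `|p| <= r -> @enorm R n p <= n.+1%:R * r.
  by move=> pr; rewrite (le_trans (enorm_le_norm p))// ler_pM2l.
have fromE (Lc : R) (u : 'rV[R]_n) p q : 0 <= Lc -> Lc <= L + L1 ->
    enorm u <= Lc * enorm (p - q) -> `|u| <= (L + L1) * n.+1%:R * @Num.norm _ 'rV[R]_n (p - q).
  move=> Lc0 LcL H'; rewrite (le_trans (norm_le_enorm u))// (le_trans H')//.
  rewrite -mulrA; apply: ler_pM => //; first exact: enorm_ge0.
  exact: enorm_le_norm.
move=> t p q tT pr qr.
have [Ha Hb] := H t p q tT (toE _ pr) (toE _ qr).
split; [apply: (fromE L) => //; lra|apply: (fromE L1) => //; lra].
Qed.

End lipschitz.

(** * The sampled discrete trajectory *)

Section mesh.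
Context {R : realType} {n m d s : nat}.
Variables (P : problem R n m d s) (k : nat).
Hypothesis k0 : (0 < k)%N.
Local Notation T := (horizon P).
Local Notation h := (hstep P k).
Local Notation mesh := (mesh P k).

Lemma hstep_gt0 : 0 < h.
Proof. by rewrite /hstep divr_gt0 ?horizon_gt0// ltr0n. Qed.

Lemma mul_hstep : k%:R * h = T.
Proof. by rewrite /hstep mulrC divfK// pnatr_eq0 -lt0n. Qed.

Lemma meshS j : mesh j.+1 = mesh j + h.
Proof. by rewrite /Defs.mesh -natr1 mulrDl mul1r. Qed.

Lemma mesh_le j : mesh j <= mesh j.+1.
Proof. by rewrite meshS lerDl ltW// hstep_gt0. Qed.

Lemma mesh_itv j : (j <= k)%N -> 0 <= mesh j <= T.
Proof.
have h0 := hstep_gt0; move=> jk.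
rewrite /Defs.mesh mulr_ge0 ?(ltW h0)//= -mul_hstep.
by rewrite ler_pM2r// ler_nat.
Qed.

End mesh.

Lemma normal_cone_closed_Cset (R : realType) (n m d s : nat) (P : problem R n m d s)
    (u x nu : 'rV[R]_n) : normal_cone (Cu P u) x nu -> closed (Cset P).
Proof.
move=> [cl _ _]; have := @closed_shift R n _ (- u) cl.
suff -> : [set y - u | y in Cu P u] = Cset P by [].
apply/seteqP; split=> [_ [_ [y Cy <-] <-]|y Cy]; first by rewrite addrK.
by exists (y + u); [exists y|rewrite addrK].
Qed.

Section construction.
Context {R : realType} {n m d s : nat}.
Variables (P : problem R n m d s) (zbar : R -> zvec R n m d).
Local Notation T := (horizon P).
Local Notation N := (n + (n + (n + (m + d))))%N.
Variable v : 'I_N -> R -> R.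

(** Both dynamics of problem (P) hold for [zbar] at the time [t], with the value
    of the density [v] as the velocity. *)
Definition dynamics_at (t : R) : Prop :=
  (exists2 nu, normal_cone (Cu P (zu (zbar t))) (zx (zbar t)) nu &
    \row_i v (ix i) t = - (nu + f1ax P (za (zbar t)) (zx (zbar t)) + zy (zbar t))) /\
  \row_i v (iy i) t = f2bx P (zb (zbar t)) (zx (zbar t)).

Variables (k : nat) (th : R).
Local Notation h := (hstep P k).
Local Notation tau := (sample_time h th).

(** The curve at the [j]-th sample time, extended by a constant to negative
    times. *)
Definition sample (j : nat) : zvec R n m d := zbar (Num.max 0 (tau j)).

(** The sampled velocities of x and y. At the sample number 0 the density vanishes
    and the dynamics need not hold; the corrections are such that the normal vector
    of the sampled inclusion is 0 there, and that the equation for y holds. *)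
Definition x_slope (j : nat) : 'rV[R]_n := \row_i v (ix i) (tau j) +
  (if j == 0%N then - f1ax P (za (zbar 0)) (zx (zbar 0)) else 0).
Definition y_slope (j : nat) : 'rV[R]_n := \row_i v (iy i) (tau j) +
  (if j == 0%N then f2bx P (zb (zbar 0)) (zx (zbar 0)) else 0).

(** One step for the states [(x, y)]: the normal vector
    [- (x_slope j + f1 (sample j) + zy (sample j))] of the sampled inclusion is
    kept, while [f1], [f2] are evaluated at the current [x], and the new value [y']
    enters the step for [x]. *)
Definition euler_step (j : nat) (p : 'rV[R]_n * 'rV[R]_n) : 'rV[R]_n * 'rV[R]_n :=
  let y' := p.2 + h *: f2bx P (zb (sample j)) p.1 in
  (p.1 + h *: (x_slope j + f1ax P (za (sample j)) (zx (sample j)) + zy (sample j)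
               - f1ax P (za (sample j)) p.1 - y'), y').

(** The states of the scheme started at [zbar 0]. *)
Definition euler_state (j : nat) := iteri j euler_step (zx (zbar 0), zy (zbar 0)).

(** The discrete trajectory: the states follow the Euler scheme, the controls a
    and b are sampled, and u is chosen so that x - u equals the sampled value of
    x - u. Hence x - u lies in C, and the cone to C + u at x contains the sampled
    normal vector. *)
Definition sampled_traj (j : nat) : zvec R n m d :=
  zcat (euler_state j).1 (euler_state j).2 ((euler_state j).1 - (zx (sample j) - zu (sample j)))
      (za (sample j)) (zb (sample j)).

Lemma euler_stateS1 j : (euler_state j.+1).1 = (euler_state j).1 +
  h *: (x_slope j + f1ax P (za (sample j)) (zx (sample j)) + zy (sample j)
  - f1ax P (za (sample j)) (euler_state j).1 - (euler_state j.+1).2).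
Proof. by []. Qed.

Lemma euler_stateS2 j : (euler_state j.+1).2 =
  (euler_state j).2 + h *: f2bx P (zb (sample j)) (euler_state j).1.
Proof. by []. Qed.

Hypothesis k2 : (1 < k)%N.
Hypothesis th0h : 0 <= th <= h.
Hypothesis v0 : forall i t, t <= 0 -> v i t = 0.
Hypothesis goodk : forall j, (0 < j <= k)%N -> dynamics_at (tau j).
Hypothesis init : zx (zbar 0) = x0 P /\ Cu P (zu (zbar 0)) (x0 P).
Hypothesis inity : zy (zbar 0) = 0.

Let h0 : 0 < h. Proof. exact: hstep_gt0 (ltnW k2). Qed.

Let kh : k%:R * h = T. Proof. exact: mul_hstep (ltnW k2). Qed.

Lemma sample_time0 : tau 0 <= 0.
Proof. by rewrite /sample_time mul0r sub0r; case/andP: th0h => *; lra. Qed.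

Lemma sample0 : sample 0 = zbar 0.
Proof. by rewrite /sample max_l// sample_time0. Qed.

Lemma sample_time_itv j : (0 < j <= k)%N -> 0 <= tau j <= T.
Proof.
case/andP: th0h => th0 thh /andP[j0 jk]; rewrite /sample_time.
have : h <= j%:R * h by rewrite ler_peMl ?ler1n// ltW.
have : j%:R * h <= T by rewrite -kh ler_pM2r// ler_nat.
by move=> *; apply/andP; split; lra.
Qed.

Lemma sampleS j : (0 < j <= k)%N -> sample j = zbar (tau j).
Proof. by move=> jk; rewrite /sample max_r//; case/andP: (sample_time_itv jk). Qed.

(* the limiting normal cone is empty unless the set is closed *)
Let closedC : closed (Cset P).
Proof.
have [[nu Hnu _] _] := @goodk 1%N (ltnW k2).
exact: normal_cone_closed_Cset Hnu.
Qed.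

Lemma sample_Cset j : (j <= k)%N -> Cset P (zx (sample j) - zu (sample j)).
Proof.
case: j => [|j] jk.
  by rewrite sample0; have [-> [y Cy <-]] := init; rewrite addrK.
rewrite sampleS//; have [[nu [_ [y Cy <-] _] _] _] := @goodk j.+1 jk.
by rewrite addrK.
Qed.

(** The normal vectors of the sampled inclusion, with the translation by u
    removed. *)
Lemma sample_normal j : (j < k)%N ->
  normal_cone (Cset P) (zx (sample j) - zu (sample j))
    (- (x_slope j + f1ax P (za (sample j)) (zx (sample j)) + zy (sample j))).
Proof.
(* at the sample number 0 the vector is 0, which is a normal vector at each
   point of the set *)
case: j => [|j] jk.
  have E i : v i (tau 0) = 0 by rewrite v0// sample_time0.
  have -> : x_slope 0 + f1ax P (za (sample 0)) (zx (sample 0)) + zy (sample 0) = 0.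
    by rewrite sample0 inity addr0; apply/rowP => i; rewrite !mxE E; ring.
  apply/normal_coneP; split; [exact: closedC|exact: sample_Cset|].
  move=> e e0; set p := zx _ - _; exists p, p, 0; split => //.
  - by rewrite subrr normr0.
  - split; first exact: sample_Cset.
    move=> w' _; rewrite subrr /enorm /dotp big1 ?sqrtr0; last by move=> i _; rewrite mxE mul0r.
    exact: sqrtr_ge0.
  - by rewrite oppr0 scale0r subr0 normr0.
have [[nu Hnu E] _] := @goodk j.+1 (ltnW jk).
rewrite sampleS ?(ltnW jk)// /x_slope /= addr0 E.
have -> : - (- (nu + f1ax P (za (zbar (tau j.+1))) (zx (zbar (tau j.+1))) +
    zy (zbar (tau j.+1))) + f1ax P (za (zbar (tau j.+1))) (zx (zbar (tau j.+1))) +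
    zy (zbar (tau j.+1))) = nu by apply/rowP => i; rewrite !mxE; ring.
apply/(@normal_cone_shift R n _ (zu (zbar (tau j.+1)))).
by rewrite subrK.
Qed.

Lemma y_slopeE j : (j < k)%N -> y_slope j = f2bx P (zb (sample j)) (zx (sample j)).
Proof.
case: j => [|j] jk.
  have E i : v i (tau 0) = 0 by rewrite v0// sample_time0.
  by rewrite sample0; apply/rowP => i; rewrite !mxE E add0r.
have [_ E] := @goodk j.+1 (ltnW jk).
by rewrite sampleS ?(ltnW jk)// /y_slope /= addr0 E.
Qed.

(** The remaining constraints of the discrete problem hold by construction. *)
Lemma sampled_traj_feasible eps :
  (forall j, (j < k)%N -> enorm (sampled_traj j - zbar (mesh P k j)) <= eps / 2) ->
  (velocity_gap P zbar k sampled_traj <= (eps / 2)%:E)%E ->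
  feasible_k P zbar eps k sampled_traj.
Proof.
move=> Hn Hg; split => //.
- move=> j jk; exists (- (x_slope j + f1ax P (za (sample j)) (zx (sample j)) + zy (sample j))
      + f1ax P (za (sample j)) (euler_state j).1 + (euler_state j.+1).2).
    rewrite /Fh /sampled_traj !zx_zcat zu_zcat zy_zcat za_zcat.
    exists (- (x_slope j + f1ax P (za (sample j)) (zx (sample j)) + zy (sample j))) => //.
    set w := zx (sample j) - zu (sample j).
    have H : normal_cone (Cu P ((euler_state j).1 - w)) (w + ((euler_state j).1 - w))
        (- (x_slope j + f1ax P (za (sample j)) (zx (sample j)) + zy (sample j))).
      by apply/normal_cone_shift; exact: sample_normal.
    by move: H; rewrite [w + _]addrC subrK.
  by rewrite /sampled_traj !zx_zcat euler_stateS1; apply/rowP => i; rewrite !mxE; ring.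
- by move=> j jk; rewrite /sampled_traj !zy_zcat zx_zcat zb_zcat euler_stateS2.
- rewrite /sampled_traj !zx_zcat zy_zcat zu_zcat za_zcat zb_zcat sample0 /euler_state /=.
  by split => //; [case: init|rewrite opprB addrC subrK].
- move=> i; rewrite /sampled_traj zx_zcat zu_zcat opprB addrC subrK.
  exact: sample_Cset.
Qed.

End construction.

Lemma rVBE (R : realType) N (a b : 'rV[R]_N) i : (a - b) 0 i = a 0 i - b 0 i.
Proof. by rewrite !mxE. Qed.

Section block_norms.
Context {R : realType} {n m d : nat}.
Implicit Types a b : zvec R n m d.

Lemma norm_zxB a b : `|zx a - zx b| <= `|a - b|.
Proof.
apply: rV_normP => // i; have := rV_coord_le (a - b) (ix i).
by rewrite !mxE.
Qed.

Lemma norm_zyB a b : `|zy a - zy b| <= `|a - b|.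
Proof.
apply: rV_normP => // i; have := rV_coord_le (a - b) (iy i).
by rewrite !mxE.
Qed.

End block_norms.

(** * Distance of the sampled trajectory to the reference curve *)

(** The parameters: [B] bounds the curve, [L] is a Lipschitz constant on the ball of
    radius [B + 1], [w] bounds the oscillation of the curve over times at most
    [2 h] apart, [etas] bounds the mean square error of the sampling, [kap] is the
    weight of Young's inequality, [eta] the error of the Euler scheme, [D0] the size of the
    corrections in the slopes number 0, [rho] the error of the slopes of the scheme,
    and [e2] the distance to be achieved, both for the nodes and, coordinate by
    coordinate, for the squared velocities. *)
Section estimates.
Context {R : realType} {n m d s : nat}.
Variables (P : problem R n m d s) (zbar : R -> zvec R n m d).
Local Notation T := (horizon P).
Local Notation N := (n + (n + (n + (m + d))))%N.
Local Notation mu := (@lebesgue_measure R).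
Variable v : 'I_N -> R -> R.
Hypothesis lv : forall i, L2loc (v i).
Hypothesis v0 : forall i t, t <= 0 -> v i t = 0.
Hypothesis zv : forall i t, t \in `[0, T] ->
  zbar t 0 i = zbar 0 0 i + itg (v i) 0 t.
Hypothesis dz : {ae mu, forall t, t \in `[0, T] ->
  forall i, derive1 zbar t 0 i = v i t}.
Variables (k : nat) (th : R).
Local Notation h := (hstep P k).
Local Notation tau := (sample_time h th).
Local Notation sample := (sample P zbar k th).
Local Notation x_slope := (x_slope P zbar v k th).
Local Notation y_slope := (y_slope P zbar v k th).
Local Notation euler_state := (euler_state P zbar v k th).
Local Notation sampled_traj := (sampled_traj P zbar v k th).
Local Notation mesh := (mesh P k).

Hypothesis k2 : (1 < k)%N.
Hypothesis th0h : 0 <= th <= h.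
Hypothesis h1 : h <= 1.
Hypothesis y_slopeE : forall j, (j < k)%N -> y_slope j = f2bx P (zb (sample j)) (zx (sample j)).

Variables (B L w kap etas eta e2 : R).
Hypotheses (L0 : 0 <= L) (w0 : 0 <= w) (kap0 : 0 < kap).
Hypothesis zB : forall t, t \in `[0, T] -> `|zbar t| <= B.
Hypothesis lip : forall t p q, t \in `[0, T] -> `|p| <= B + 1 -> `|q| <= B + 1 ->
  `|f1ax P (za (zbar t)) p - f1ax P (za (zbar t)) q| <= L * `|p - q| /\
  `|f2bx P (zb (zbar t)) p - f2bx P (zb (zbar t)) q| <= L * `|p - q|.
Hypothesis modulus : forall i s t, - T <= s -> s <= t -> t <= T -> t - s <= 2 * h ->
  `|zbar (Num.max 0 t) 0 i - zbar (Num.max 0 s) 0 i| <= w.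
Hypothesis samp1 : forall i,
  \sum_(j < k) itg (fun t => (v i (tau j) - v i t) ^+ 2) (mesh j) (mesh j.+1) <= etas.
Hypothesis samp2 : forall i,
  \sum_(j < k) itg (fun t => (h^-1 * itg (v i) (tau j) (tau j.+1) - v i t) ^+ 2)
    (mesh j) (mesh j.+1) <= etas.

Let F1 := f1ax P (za (zbar 0)) (zx (zbar 0)).
Let F2 := f2bx P (zb (zbar 0)) (zx (zbar 0)).
Let D0 := `|F1| + `|F2|.
Hypothesis small : expR ((3 * L + 1) * T) *
  (2 * (N%:R * (T * kap + etas / kap) + h * D0) + (3 * L + 1) * T * w) <= eta.
Hypothesis eta1 : eta <= 1.
Hypothesis eta_e2 : eta + 2 * w <= e2.
Let rho := (L + 1) * (eta + w).
Hypothesis gap_e2 :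
  3 * (2 * etas + 4 * T * rho ^+ 2 + 4 * h * D0 ^+ 2) + 6 * etas <= e2.

Let T0 : 0 < T. Proof. exact: horizon_gt0. Qed.

Let k0 : (0 < k)%N. Proof. exact: ltnW k2. Qed.

Let h0 : 0 < h. Proof. exact: hstep_gt0. Qed.

Let kh : k%:R * h = T. Proof. exact: mul_hstep. Qed.

Let mesh_itv j : (j <= k)%N -> 0 <= mesh j <= T. Proof. exact: mesh_itv. Qed.

Let mesh_max j : (j <= k)%N -> zbar (Num.max 0 (mesh j)) = zbar (mesh j).
Proof. by move=> /mesh_itv/andP[m0 _]; rewrite max_r. Qed.

Let tau_mesh j : tau j = mesh j - h + th. Proof. by []. Qed.

Let tauS j : tau j.+1 = tau j + h.
Proof. by rewrite !tau_mesh meshS; ring. Qed.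

Let tauT j : (j <= k)%N -> - T <= tau j /\ tau j <= T.
Proof.
move=> /mesh_itv/andP[m0 mT]; rewrite tau_mesh; case/andP: th0h => t1 t2.
have hT : h <= T.
  have k1 : 1 <= k%:R :> R by rewrite ler1n.
  by have := kh; have := h0; nra.
by move=> *; split; lra.
Qed.

Let sample_itv j : (j <= k)%N -> Num.max 0 (tau j) \in `[0, T].
Proof.
move=> /tauT[_ tT]; rewrite in_itv/= le_max lexx/= ge_max tT andbT.
exact: ltW.
Qed.

Let sample_mesh j : (j <= k)%N -> `|sample j - zbar (mesh j)| <= w.
Proof.
move=> jk; apply: rV_normP => // i; rewrite !mxE -(mesh_max jk) distrC.
have [t1 t2] := tauT jk; have /andP[m0 mT] := mesh_itv jk.
by apply: modulus => //; rewrite ?tau_mesh; case/andP: th0h => *; have := h0; lra.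
Qed.

Let sample_meshS j : (j < k)%N -> `|sample j - zbar (mesh j.+1)| <= w.
Proof.
move=> jk; apply: rV_normP => // i; rewrite !mxE -(mesh_max jk) distrC.
have [t1 t2] := tauT (ltnW jk); have /andP[m0 mT] := mesh_itv jk.
apply: modulus => //; rewrite ?tau_mesh; case/andP: th0h => *; have := h0;
  rewrite ?meshS; lra.
Qed.

Let D0_ge0 : 0 <= D0. Proof. by rewrite addr_ge0. Qed.

Let dd i j := itg (fun t => (v i (tau j) - v i t) ^+ 2) (mesh j) (mesh j.+1).
Let dd_ge0 i j : 0 <= dd i j. Proof. by apply: itg_ge0 => t; exact: sqr_ge0. Qed.

(* a bound, common to all coordinates, of the error made when an increment of
   the curve over a mesh interval is replaced by [h] times the sampled density *)
Let g j := \sum_(i < N) (h * kap + dd i j / kap) / 2.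

Let term_ge0 i j : 0 <= (h * kap + dd i j / kap) / 2.
Proof.
apply: divr_ge0 => //; apply: addr_ge0; first by rewrite mulr_ge0// ltW.
by apply: divr_ge0 => //; exact: ltW.
Qed.

Let lq i (q : R) : L2loc (fun t => q - v i t).
Proof. by apply: L2locB => //; exact: L2loc_cst. Qed.

Let quad i j : (j < k)%N ->
  `|h * v i (tau j) - (zbar (mesh j.+1) 0 i - zbar (mesh j) 0 i)| <= g j.
Proof.
move=> jk; have jk' := ltnW jk.
have mm : mesh j <= mesh j.+1 by rewrite meshS lerDl ltW.
rewrite -(mesh_max jk) -(mesh_max jk').
rewrite (primitive_incr lv v0 zv i mm); last by case/andP: (mesh_itv jk).
have hm : h = mesh j.+1 - mesh j by rewrite meshS addrC addKr.
rewrite [in h * _]hm -itg_cst// -itgB; last 2 first.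
- exact: locint_cst.
- exact: L2loc_locint.
apply: (le_trans (normr_itg_le (lq i _) mm kap0)).
by rewrite -hm /g (bigD1 i)//= lerDl; apply: sumr_ge0.
Qed.

Let g_ge0 j : 0 <= g j.
Proof.
exact: sumr_ge0.
Qed.

(* the indicator of the step number 0 *)
Let z1 (j : nat) : R := (j == 0%N)%:R.

Let x_slope_err j : (j < k)%N ->
  `|h *: x_slope j - (zx (zbar (mesh j.+1)) - zx (zbar (mesh j)))| <= g j + z1 j * (h * `|F1|).
Proof.
move=> jk; apply: rV_normP.
  by rewrite addr_ge0// !mulr_ge0 ?ler0n// ltW.
move=> i; have := quad (ix i) jk.
rewrite !mxE /z1; case: ifP => [/eqP ->|_]; rewrite ?mul1r ?mul0r !mxE.
  move=> H; rewrite mulrDr addrAC (le_trans (ler_normD _ _))// lerD//.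
  by rewrite mulrN normrN normrM gtr0_norm// ler_pM2l// rV_coord_le.
by rewrite !addr0.
Qed.

Let y_slope_err j : (j < k)%N ->
  `|h *: y_slope j - (zy (zbar (mesh j.+1)) - zy (zbar (mesh j)))| <= g j + z1 j * (h * `|F2|).
Proof.
move=> jk; apply: rV_normP.
  by rewrite addr_ge0// !mulr_ge0 ?ler0n// ltW.
move=> i; have := quad (iy i) jk.
rewrite !mxE /z1; case: ifP => [/eqP ->|_]; rewrite ?mul1r ?mul0r ?mxE.
  move=> H; rewrite mulrDr addrAC (le_trans (ler_normD _ _))// lerD//.
  by rewrite normrM gtr0_norm// ler_pM2l// rV_coord_le.
by rewrite !addr0.
Qed.

Let delta j := 2 * g j + z1 j * (h * D0).

Let sum_delta : \sum_(j < k) delta j <= N%:R * (T * kap + etas / kap) + h * D0.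
Proof.
rewrite /delta big_split/= -mulr_sumr -mulr_suml; apply: lerD.
  rewrite /g exchange_big/= mulr_sumr.
  apply: (@le_trans _ _ (\sum_(i < N) (T * kap + etas / kap))); last first.
    by rewrite sumr_const card_ord -[_ *+ N]mulr_natl.
  apply: ler_sum => i _; rewrite -mulr_suml mulrC divfK// big_split/=.
  rewrite sumr_const card_ord -[_ *+ k]mulr_natl mulrA kh lerD2l -mulr_suml.
  by rewrite ler_pM2r ?invr_gt0//; exact: samp1.
rewrite -[leRHS]mul1r; apply: ler_wpM2r; first by rewrite mulr_ge0// ltW.
move: k0; case: (k) => // l _; rewrite big_ord_recl /z1/= big1 ?addr0//.
Qed.

Let state0 : (euler_state 0).1 = zx (zbar (mesh 0)) /\ (euler_state 0).2 = zy (zbar (mesh 0)).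
Proof. by rewrite /Defs.mesh mul0r. Qed.

Let xsr j : (j <= k)%N -> `|zx (sample j)| <= B.
Proof. by move=> jk; rewrite (le_trans (norm_zx _))// zB// sample_itv. Qed.

Let lipa j p q : (j < k)%N -> `|p| <= B + 1 -> `|q| <= B + 1 ->
  `|f1ax P (za (sample j)) p - f1ax P (za (sample j)) q| <= L * `|p - q|.
Proof. by move=> jk pB qB; have [] := lip (sample_itv (ltnW jk)) pB qB. Qed.

Let lipb j p q : (j < k)%N -> `|p| <= B + 1 -> `|q| <= B + 1 ->
  `|f2bx P (zb (sample j)) p - f2bx P (zb (sample j)) q| <= L * `|p - q|.
Proof. by move=> jk pB qB; have [] := lip (sample_itv (ltnW jk)) pB qB. Qed.

Let small' : expR ((3 * L + 1) * T) *
  (2 * \sum_(j < k) delta j + (3 * L + 1) * T * w) <= eta.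
Proof.
apply: le_trans small; rewrite ler_pM2l ?expR_gt0// lerD2r ler_pM2l//.
Qed.

Let err j : (j < k)%N ->
  `|h *: x_slope j - (zx (zbar (mesh j.+1)) - zx (zbar (mesh j)))| +
  `|h *: y_slope j - (zy (zbar (mesh j.+1)) - zy (zbar (mesh j)))| <= delta j.
Proof.
move=> jk; apply: (le_trans (lerD (x_slope_err jk) (y_slope_err jk))).
by rewrite /delta /D0 le_eqVlt; apply/orP; left; apply/eqP; ring.
Qed.

Let X j := zx (zbar (mesh j)).
Let Y j := zy (zbar (mesh j)).

Let xsX j : (j < k)%N -> `|zx (sample j) - X j| <= w.
Proof. by move=> jk; rewrite (le_trans (norm_zxB _ _))// sample_mesh// ltnW. Qed.

Let ysY j : (j < k)%N -> `|zy (sample j) - Y j.+1| <= w.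
Proof. by move=> jk; rewrite (le_trans (norm_zyB _ _))// sample_meshS. Qed.

Let Xr j : (j < k)%N -> `|X j| <= B + 1 - 1.
Proof.
move=> jk; rewrite addrK (le_trans (norm_zx _))// zB// in_itv/=.
exact: mesh_itv (ltnW jk).
Qed.

Let xsr' j : (j < k)%N -> `|zx (sample j)| <= B + 1.
Proof. by move=> jk; rewrite (le_trans (xsr (ltnW jk)))// lerDl. Qed.

Let stab j : (j <= k)%N ->
  `|(euler_state j).1 - X j| + `|(euler_state j).2 - Y j| <= eta.
Proof.
apply: (@euler_stability R n k h T L (B + 1) eta w
  (fun j => (euler_state j).1) (fun j => (euler_state j).2)
  (fun j => zx (sample j)) (fun j => zy (sample j)) X Y x_slope y_slope
  (fun j => f1ax P (za (sample j))) (fun j => f2bx P (zb (sample j))) delta) => //.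
- by case: state0.
- by case: state0.
Qed.

Let veloc j : (j < k)%N ->
  `|h^-1 *: ((euler_state j.+1).1 - (euler_state j).1) - x_slope j| <= rho /\
  `|h^-1 *: ((euler_state j.+1).2 - (euler_state j).2) - y_slope j| <= rho.
Proof.
apply: (@euler_velocity R n k h T L (B + 1) eta w
  (fun j => (euler_state j).1) (fun j => (euler_state j).2)
  (fun j => zx (sample j)) (fun j => zy (sample j)) X Y x_slope y_slope
  (fun j => f1ax P (za (sample j))) (fun j => f2bx P (zb (sample j))) delta) => //.
- by case: state0.
- by case: state0.
Qed.

(** The distance between the nodes in the maximum norm. *)
Lemma sampled_traj_close j : (j < k)%N -> `|sampled_traj j - zbar (mesh j)| <= e2.
Proof.
move=> jk; have H := stab (ltnW jk); have Hs := sample_mesh (ltnW jk).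
have n1 := normr_ge0 ((euler_state j).1 - X j); have n2 := normr_ge0 ((euler_state j).2 - Y j).
have := eta_e2; have := w0 => w0' ee2.
have c (i : 'I_N) : `|sample j 0 i - zbar (mesh j) 0 i| <= w.
  by apply: le_trans Hs; have := rV_coord_le (sample j - zbar (mesh j)) i; rewrite !mxE.
have e20 : 0 <= e2 by lra.
apply: rV_normP => //; apply: block_ind => i.
- rewrite rVBE -!zxE /sampled_traj zx_zcat.
  have := rV_coord_le ((euler_state j).1 - X j) i; rewrite rVBE /X; lra.
- rewrite rVBE -!zyE /sampled_traj zy_zcat.
  have := rV_coord_le ((euler_state j).2 - Y j) i; rewrite rVBE /Y; lra.
- rewrite rVBE -!zuE /sampled_traj zu_zcat !rVBE !zxE !zuE.
  have := rV_coord_le ((euler_state j).1 - X j) i; rewrite rVBE /X zxE.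
  have := c (ix i); have := c (iu i).
  set p := (euler_state j).1 0 i; set a := sample j 0 _; set b := zbar _ 0 _.
  set a' := sample j 0 _; set b' := zbar _ 0 _ => ha hb hp.
  have -> : p - (a' - a) - b = (p - b') + ((a - b) - (a' - b')) by ring.
  rewrite (le_trans (ler_normD _ _))//.
  have := ler_normB (a - b) (a' - b'); lra.
- rewrite rVBE -!zaE /sampled_traj za_zcat !zaE; have := c (ia i); lra.
- rewrite rVBE -!zbE /sampled_traj zb_zcat !zbE; have := c (ib i); lra.
Qed.

Let sum_z1 : \sum_(j < k) z1 j <= 1.
Proof.
by move: k0; case: (k) => // l _; rewrite big_ord_recl /z1/= big1 ?addr0.
Qed.

Let mesh_le j : mesh j <= mesh j.+1. Proof. exact: mesh_le. Qed.

Let lqs i (q : R) : locint (fun t => (q - v i t) ^+ 2).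
Proof. by have [] := lq i q. Qed.

(* a coordinate whose difference quotients are close to the sampled density *)
Let gap_state i (q : nat -> R) :
  (forall j, (j < k)%N -> `|q j - v i (tau j)| <= rho + z1 j * D0) ->
  \sum_(j < k) itg (fun t => (q j - v i t) ^+ 2) (mesh j) (mesh j.+1)
  <= 2 * etas + 4 * T * rho ^+ 2 + 4 * h * D0 ^+ 2.
Proof.
move=> Hq.
have step (j : 'I_k) : itg (fun t => (q j - v i t) ^+ 2) (mesh j) (mesh j.+1) <=
    2 * dd i j + (h * (4 * rho ^+ 2) + z1 j * (4 * h * D0 ^+ 2)).
  have hm : h = mesh j.+1 - mesh j by rewrite meshS addrC addKr.
  set e := 4 * rho ^+ 2 + z1 j * (4 * D0 ^+ 2).
  have -> : h * (4 * rho ^+ 2) + z1 j * (4 * h * D0 ^+ 2) = itg (fun=> e) (mesh j) (mesh j.+1).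
    by rewrite itg_cst// -hm /e; ring.
  rewrite -itgZ// -itgD; [|exact: locintZ|exact: locint_cst].
  apply: le_itg => //; first by apply: locintD; [exact: locintZ|exact: locint_cst].
  move=> t _.
  have Hj := Hq j (ltn_ord j).
  have a1 : (q j - v i (tau j)) ^+ 2 <= (rho + z1 j * D0) ^+ 2.
    rewrite -[leLHS]real_normK ?num_real// ler_sqr ?nnegrE//.
    exact: le_trans Hj.
  have a2 : (rho + z1 j * D0) ^+ 2 <= 2 * rho ^+ 2 + z1 j * (2 * D0 ^+ 2).
    rewrite /z1; case: (_ == _); last by rewrite !mul0r !addr0; have := sqr_ge0 rho; lra.
    by rewrite !mul1r; have := sqr_ge0 (rho - D0); nra.
  have -> : q j - v i t = (q j - v i (tau j)) + (v i (tau j) - v i t) by ring.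
  set a := q j - _ in a1 *; set b := v i (tau j) - _.
  have a3 : (a + b) ^+ 2 <= 2 * b ^+ 2 + 2 * a ^+ 2.
    by have := sqr_ge0 (a - b); nra.
  apply: (le_trans a3); rewrite lerD2l /e.
  by move: a1 a2; set c := (rho + _) ^+ 2; set c' := a ^+ 2; lra.
apply: (le_trans (ler_sum _ (fun j _ => step j))).
rewrite big_split/= big_split/= -mulr_sumr -mulr_suml sumr_const card_ord.
rewrite -[_ *+ k]mulr_natl mulrA kh -addrA; apply: lerD.
  by rewrite ler_pM2l//; exact: samp1.
apply: lerD; first by rewrite le_eqVlt; apply/orP; left; apply/eqP; ring.
rewrite -mulr_suml. rewrite -[leRHS]mul1r; apply: ler_wpM2r => //.
by rewrite !mulr_ge0 ?sqr_ge0// ltW.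
Qed.

Let q j := dquot P k sampled_traj j.

Let qx j i : q j 0 (ix i) = (h^-1 *: ((euler_state j.+1).1 - (euler_state j).1)) 0 i.
Proof.
rewrite /q /dquot mxE rVBE -!zxE /sampled_traj !zx_zcat.
by rewrite [in RHS]mxE rVBE.
Qed.

Let qy j i : q j 0 (iy i) = (h^-1 *: ((euler_state j.+1).2 - (euler_state j).2)) 0 i.
Proof.
rewrite /q /dquot mxE rVBE -!zyE /sampled_traj !zy_zcat.
by rewrite [in RHS]mxE rVBE.
Qed.

Let sample_incr i j : (j < k)%N ->
  h^-1 * (sample j.+1 0 i - sample j 0 i) = h^-1 * itg (v i) (tau j) (tau j.+1).
Proof.
move=> jk; have [_ t2] := tauT jk; congr (_ * _).
by apply: (primitive_incr lv v0 zv) => //; rewrite tauS lerDl ltW.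
Qed.

Let etas0 (i : 'I_N) : 0 <= etas.
Proof. by apply: le_trans (samp1 i); apply: sumr_ge0 => j _; exact: dd_ge0. Qed.

Let Trho0 : 0 <= 4 * T * rho ^+ 2.
Proof. exact: (mulr_ge0 (mulr_ge0 (ler0n R 4) (ltW T0)) (sqr_ge0 _)). Qed.

Let hD00 : 0 <= 4 * h * D0 ^+ 2.
Proof. exact: (mulr_ge0 (mulr_ge0 (ler0n R 4) (ltW h0)) (sqr_ge0 _)). Qed.

Let gam_e2 (i : 'I_N) : 2 * etas + 4 * T * rho ^+ 2 + 4 * h * D0 ^+ 2 <= e2.
Proof.
have := gap_e2; have := etas0 i.
have := Trho0.
have := hD00.
lra.
Qed.

Let x_slope_coord j i : x_slope j 0 i = v (ix i) (tau j) + (if j == 0%N then - F1 else 0) 0 i.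
Proof. by rewrite mxE; congr (_ + _); rewrite mxE. Qed.

Let y_slope_coord j i : y_slope j 0 i = v (iy i) (tau j) + (if j == 0%N then F2 else 0) 0 i.
Proof. by rewrite mxE; congr (_ + _); rewrite mxE. Qed.

Let q_err_x j i : (j < k)%N -> `|q j 0 (ix i) - v (ix i) (tau j)| <= rho + z1 j * D0.
Proof.
move=> jk; have [H _] := veloc jk.
have := le_trans (rV_coord_le _ i) H; rewrite rVBE -qx x_slope_coord.
set c := q j 0 _; set u := v _ _; set bv := (if _ then _ else _); set b := bv 0 i => Hc.
have -> : c - u = (c - (u + b)) + b by ring.
rewrite (le_trans (ler_normD _ _))// lerD//.
rewrite /b /bv /z1; case: ifP => _; last by rewrite mxE normr0 mul0r.
rewrite mul1r mxE normrN (le_trans (rV_coord_le _ _))//.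
by rewrite /D0 lerDl.
Qed.

Let q_err_y j i : (j < k)%N -> `|q j 0 (iy i) - v (iy i) (tau j)| <= rho + z1 j * D0.
Proof.
move=> jk; have [_ H] := veloc jk.
have := le_trans (rV_coord_le _ i) H; rewrite rVBE -qy y_slope_coord.
set c := q j 0 _; set u := v _ _; set bv := (if _ then _ else _); set b := bv 0 i => Hc.
have -> : c - u = (c - (u + b)) + b by ring.
rewrite (le_trans (ler_normD _ _))// lerD//.
rewrite /b /bv /z1; case: ifP => _; last by rewrite mxE normr0 mul0r.
rewrite mul1r (le_trans (rV_coord_le _ _))//.
by rewrite /D0 lerDr.
Qed.

(* a coordinate whose difference quotients are means of the density between
   consecutive sample times *)
Let gap_control i (qq : nat -> R) : (forall j, (j < k)%N ->
    qq j = h^-1 * itg (v i) (tau j) (tau j.+1)) ->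
  \sum_(j < k) itg (fun t => (qq j - v i t) ^+ 2) (mesh j) (mesh j.+1) <= e2.
Proof.
move=> E; apply: (@le_trans _ _ etas); last first.
  have := gam_e2 i; have := etas0 i.
  have := Trho0.
  have := hD00.
  lra.
apply: le_trans (samp2 i); apply: ler_sum => j _.
by rewrite E.
Qed.

Let gap_comp i :
  \sum_(j < k) itg (fun t => (q j 0 i - v i t) ^+ 2) (mesh j) (mesh j.+1) <= e2.
Proof.
move: i; apply: block_ind => i.
- apply: le_trans (gam_e2 (ix i)); apply: (@gap_state (ix i) (fun j => q j 0 (ix i))).
  by move=> j jk; exact: q_err_x.
- apply: le_trans (gam_e2 (ix i)); apply: (@gap_state (iy i) (fun j => q j 0 (iy i))).
  by move=> j jk; exact: q_err_y.
(* the block u is x minus the sampled x - u *)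
- pose Ax j := h^-1 * itg (v (ix i)) (tau j) (tau j.+1).
  pose Au j := h^-1 * itg (v (iu i)) (tau j) (tau j.+1).
  have qu j : (j < k)%N -> q j 0 (iu i) = q j 0 (ix i) - Ax j + Au j.
    move=> jk; rewrite /Ax /Au -!sample_incr// qx /q /dquot mxE rVBE -!zuE.
    rewrite /sampled_traj !zu_zcat !rVBE !zxE !zuE [X in _ = X - _ + _]mxE rVBE.
    ring.
  have step (j : 'I_k) : itg (fun t => (q j 0 (iu i) - v (iu i) t) ^+ 2)
      (mesh j) (mesh j.+1) <=
    3 * (itg (fun t => (q j 0 (ix i) - v (ix i) t) ^+ 2) (mesh j) (mesh j.+1) +
         itg (fun t => (Ax j - v (ix i) t) ^+ 2) (mesh j) (mesh j.+1) +
         itg (fun t => (Au j - v (iu i) t) ^+ 2) (mesh j) (mesh j.+1)).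
    rewrite -itgD// -itgD//; last exact: locintD.
    rewrite -itgZ; last by apply: locintD => //; exact: locintD.
    apply: le_itg => //.
      by apply: locintZ; apply: locintD => //; exact: locintD.
    move=> t _; rewrite qu//.
    set a := v (ix i) t; set b := v (iu i) t.
    set c := q j 0 (ix i); set A := Ax j; set B' := Au j.
    have := sqr_ge0 ((c - a) + (A - a)); have := sqr_ge0 ((c - a) - (B' - b)).
    have := sqr_ge0 ((A - a) + (B' - b)).
    have -> : c - A + B' - b = (c - a) - (A - a) + (B' - b) by ring.
    set p := c - a; set p' := A - a; set p'' := B' - b; nra.
  apply: (le_trans (ler_sum _ (fun j _ => step j))).
  rewrite -mulr_sumr big_split/= big_split/=.
  have H1 := @gap_state (ix i) (fun j => q j 0 (ix i)) (fun j => @q_err_x j i).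
  have H2 := samp2 (ix i); have H3 := samp2 (iu i).
  apply: le_trans gap_e2.
  have -> : 6 * etas = 3 * (etas + etas) by ring.
  rewrite -mulrDr ler_pM2l// -addrA; apply: lerD => //.
  exact: lerD.
- apply: (@gap_control (ia i) (fun j => q j 0 (ia i))) => j jk.
  by rewrite -sample_incr// /q /dquot mxE rVBE -!zaE /sampled_traj !za_zcat !zaE.
- apply: (@gap_control (ib i) (fun j => q j 0 (ib i))) => j jk.
  by rewrite -sample_incr// /q /dquot mxE rVBE -!zbE /sampled_traj !zb_zcat !zbE.
Qed.

(** The mean square distance between the velocities. *)
Lemma sampled_traj_gap : (velocity_gap P zbar k sampled_traj <= (N%:R * e2)%:E)%E.
Proof.
rewrite /velocity_gap.
have -> : (\sum_(j < k) \int[mu]_(t in `[mesh j, mesh j.+1])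
     (enorm (dquot P k sampled_traj j - derive1 zbar t) ^+ 2)%R%:E)%E =
  (\sum_(j < k) \sum_(i < N)
    itg (fun t => (q j 0 i - v i t) ^+ 2) (mesh j) (mesh j.+1))%:E.
  rewrite -sumEFin; apply: eq_bigr => j _.
  have /andP[m0 _] := mesh_itv (ltnW (ltn_ord j)).
  have /andP[_ mT] := mesh_itv (ltn_ord j).
  exact: (integral_gap lv dz).
rewrite lee_fin exchange_big/=.
apply: (@le_trans _ _ (\sum_(i < N) e2)); first by apply: ler_sum => i _; exact: gap_comp.
by rewrite sumr_const card_ord -[_ *+ N]mulr_natl.
Qed.

End estimates.

(** * Existence of feasible discrete trajectories *)

(** The order in which the parameters of the estimates are chosen: the target
    [e] and the data [N], [L], [T], [D] determine [eta], then [kap] and [w], then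
    [etas], and finally the bound [hm] of the step. *)
Lemma tolerances (R : realType) (N : nat) (L T D e : R) :
  0 <= L -> 0 < T -> 0 <= D -> 0 < e ->
  exists kap w etas eta hm : R,
    [/\ 0 < kap, 0 < w, 0 < etas, eta <= 1 & 0 < hm /\
    forall h, 0 < h -> h <= hm ->
    [/\ expR ((3 * L + 1) * T) *
          (2 * (N%:R * (T * kap + etas / kap) + h * D) + (3 * L + 1) * T * w) <= eta,
        eta + 2 * w <= e &
        3 * (2 * etas + 4 * T * ((L + 1) * (eta + w)) ^+ 2 + 4 * h * D ^+ 2)
          + 6 * etas <= e]].
Proof.
move=> L0 T0 D0 e0.
have le_min2 (a b c : R) : c = Num.min a b -> c <= a /\ c <= b.
  by move=> ->; rewrite !ge_min !lexx orbT.
set C := expR _; set K := (3 * L + 1) * T.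
have C0 : 0 < C by exact: expR_gt0.
have K0 : 0 < K by apply: mulr_gt0 => //; lra.
clearbody C K.
(* [r] bounds the velocity error, whose square enters the gap with factor 12 T *)
pose r := Num.min 1 (e / (36 * T)).
have [r1 r2] := le_min2 1 (e / (36 * T)) r erefl.
have r0 : 0 < r by rewrite lt_min ltr01/= divr_gt0// mulr_gt0.
pose eta := Num.min (Num.min 1 (e / 3)) (r / (2 * (L + 1))).
have L1 : 0 < 2 * (L + 1) by lra.
have [eta12 eta3] := le_min2 _ _ eta erefl.
have [eta1 eta2] := le_min2 1 (e / 3) _ erefl.
have {eta1} eta1 := le_trans eta12 eta1; have {eta2 eta12} eta2 := le_trans eta12 eta2.
have eta0 : 0 < eta by rewrite !lt_min ltr01/= !divr_gt0.
rewrite ler_pdivlMr// in eta3.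
have N0 : 0 < N.+1%:R :> R by rewrite ltr0n.
have T10 : 0 < T + 1 by rewrite addr_gt0.
have NT0 : 0 < N.+1%:R * (T + 1) by rewrite mulr_gt0.
pose kap := eta / (6 * C * (N.+1%:R * (T + 1))).
have kap0 : 0 < kap by rewrite divr_gt0// !mulr_gt0.
have kapE : 6 * C * (N.+1%:R * (T + 1)) * kap = eta.
  by rewrite mulrC divfK// gt_eqF// !mulr_gt0.
pose w := Num.min eta (eta / (3 * C * K)).
have [w1 w2] := le_min2 _ _ w erefl.
have w0 : 0 < w by rewrite lt_min eta0/= divr_gt0// !mulr_gt0.
rewrite ler_pdivlMr ?mulr_gt0// in w2.
pose etas := Num.min (kap ^+ 2) (e / 36).
have [es1 es2] := le_min2 _ _ etas erefl.
have es0 : 0 < etas by rewrite lt_min exprn_gt0//= divr_gt0.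
pose hm := Num.min (eta / (6 * C * (D + 1))) (e / (36 * (D ^+ 2 + 1))).
have [hm1 hm2] := le_min2 _ _ hm erefl.
have D1 : 0 < D + 1 by lra.
have D2 : 0 < D ^+ 2 + 1 by rewrite ltr_wpDl ?sqr_ge0.
have hm0 : 0 < hm by rewrite lt_min !divr_gt0// !mulr_gt0.
exists kap, w, etas, eta, hm; split => //; split => // h h0 hhm.
have h1 : h * (6 * C * (D + 1)) <= eta.
  by rewrite -ler_pdivlMr ?(le_trans hhm hm1)// !mulr_gt0.
have h2 : h * (36 * (D ^+ 2 + 1)) <= e.
  by rewrite -ler_pdivlMr ?(le_trans hhm hm2)// !mulr_gt0.
split.
- have q1 : etas / kap <= kap by rewrite ler_pdivrMr// -expr2.
  have q2 : N%:R * (T * kap + etas / kap) <= N.+1%:R * (T + 1) * kap.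
    rewrite -mulrA; apply: ler_pM => //.
    - exact: (addr_ge0 (mulr_ge0 (ltW T0) (ltW kap0)) (divr_ge0 (ltW es0) (ltW kap0))).
    - by rewrite ler_nat.
    - by rewrite mulrDl mul1r lerD2l.
  have q3 : C * (N%:R * (T * kap + etas / kap)) <= C * (N.+1%:R * (T + 1) * kap).
    by rewrite ler_pM2l.
  have q4 : 6 * (C * (N.+1%:R * (T + 1) * kap)) = eta by rewrite -kapE; ring.
  have q5 : h * (6 * C * D) <= h * (6 * C * (D + 1)).
    by rewrite !ler_pM2l ?mulr_gt0// lerDl.
  clearbody eta kap w etas; move: q3 q4 q5 h1 w2; clear.
  set X1 := N%:R * _; set X2 := N.+1%:R * _ * _; lra.
- by move: w1 eta2; clear; lra.
- set rho := (L + 1) * (eta + w).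
  have rho0 : 0 <= rho.
    exact: (mulr_ge0 (addr_ge0 L0 ler01) (addr_ge0 (ltW eta0) (ltW w0))).
  have rho1 : rho <= r.
    apply: le_trans eta3; rewrite /rho (_ : eta * _ = (L + 1) * (eta + eta)); last by ring.
    by rewrite ler_wpM2l ?lerD2l// addr_ge0.
  have r3 : rho ^+ 2 <= e / (36 * T).
    apply: le_trans r2; apply: (@le_trans _ _ (rho * r)).
      by rewrite expr2 ler_wpM2l.
    by apply: ler_piMl; [exact: ltW|exact: le_trans r1].
  have r4 : T * rho ^+ 2 <= e / 36.
    by move: r3; rewrite invfM mulrA ler_pdivlMr// mulrC.
  have r5 : h * D ^+ 2 <= h * (D ^+ 2 + 1) by rewrite ler_pM2l// lerDl.
  by clearbody rho eta w etas; move: r4 r5 h2 es2; clear; lra.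
Qed.

Section existence.
Context {R : realType} {n m d s : nat}.
Variables (P : problem R n m d s) (zbar : R -> zvec R n m d).
Local Notation T := (horizon P).
Local Notation N := (n + (n + (n + (m + d))))%N.
Local Notation mu := (@lebesgue_measure R).

(** Feasibility of [zbar], with the density in place of the derivative. *)
Lemma ae_dynamics_at (v : 'I_N -> R -> R) : feasible P zbar ->
  {ae mu, forall t, t \in `[0, T] -> forall i, derive1 zbar t 0 i = v i t} ->
  {ae mu, forall t, t \in `[0, T] -> dynamics_at P zbar v t}.
Proof.
move=> [_ fx fy _ _] dz.
have aeF : Filter (nbhs (almost_everywhere mu)) by exact: (ae_filter_ringOfSetsType mu).
have := @filterI _ _ aeF _ _ (@filterI _ _ aeF _ _ fx fy) dz.
apply: (@filterS _ _ aeF) => t [[Hx Hy] Hz] tT.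
split.
  have [nu Hnu E] := Hx tT; exists nu => //.
  rewrite E opprK; apply/rowP => i; rewrite mxE zxE.
  by rewrite Hz.
rewrite -Hy//; apply/rowP => i; rewrite mxE zyE.
by rewrite Hz.
Qed.

(** For fine meshes a sampled trajectory satisfies the tube and the velocity
    constraints. *)
Lemma feasible_k_exists eps : feasible P zbar -> H2_lipschitz P -> 0 < eps ->
  \forall k \near \oo, exists z, feasible_k P zbar eps k z.
Proof.
move=> fz HL eps0; have T0 := horizon_gt0 P.
have [W _ _ init inity] := fz.
have [v [lv v0 zv dz]] := W12_density T0 W.
have [Z [mZ Z0 goodZ]] := ae_dynamics_at fz dz.
have goodP t : t \in `[0, T] -> ~ Z t -> dynamics_at P zbar v t.
  by move=> tT nZ; apply: contrapT => ng; apply: nZ; apply: goodZ => /= /(_ tT).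
have [B B0 zB] := primitive_bounded T0 lv zv.
have [L L0 lip] := H2_lipschitz_norm HL W (ltr_wpDl B0 ltr01).
(* the size of the corrections in the slopes number 0 *)
pose D0 := `|f1ax P (za (zbar 0)) (zx (zbar 0))| + `|f2bx P (zb (zbar 0)) (zx (zbar 0))|.
have D00 : 0 <= D0 by rewrite addr_ge0.
have N10 : 0 < N.+1%:R :> R by rewrite ltr0n.
(* the factor [N.+1] pays for the Euclidean norm and for the sum over the
   coordinates in the velocity gap *)
pose e2 := eps / 2 / N.+1%:R.
have e20 : 0 < e2 by rewrite !divr_gt0.
have [kap [w [etas [eta [hm [kap0 w0 es0 eta1 [hm0 small]]]]]]] :=
  tolerances N L0 T0 D00 e20.
have [dd dd0 modulus] := primitive_modulus lv v0 zv w0.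
have samp := sampling T0 lv mZ Z0 es0.
near=> k.
have k2 : (1 < k)%N by near: k; exact: nbhs_infty_gt.
have k0 : 0 < k%:R :> R by rewrite ltr0n (ltn_trans _ k2).
have h0 : 0 < hstep P k by rewrite /hstep divr_gt0.
have hle c : 0 < c -> T / c <= k%:R -> hstep P k <= c.
  by move=> c0; rewrite /hstep ler_pdivrMr// mulrC -ler_pdivrMr.
have h1 : hstep P k <= 1 by apply: hle => //; near: k; exact: nbhs_infty_ger.
have h2 : hstep P k <= hm by apply: hle => //; near: k; exact: nbhs_infty_ger.
have h4 : 2 * hstep P k <= dd.
  rewrite mulrC -ler_pdivlMr//; apply: hle; first exact: divr_gt0.
  by near: k; exact: nbhs_infty_ger.
have {small} [small small2 small3] := small _ h0 h2.
have [th [th0h nZ S1 S2]] : exists th, [/\ 0 <= th <= hstep P k,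
    forall j, (j <= k)%N -> ~ Z (sample_time (hstep P k) th j),
    forall i, \sum_(j < k) itg (fun t => (v i (sample_time (hstep P k) th j) - v i t) ^+ 2)
      (mesh P k j) (mesh P k j.+1) <= etas &
    forall i, \sum_(j < k) itg (fun t =>
      ((hstep P k)^-1 * itg (v i) (sample_time (hstep P k) th j)
        (sample_time (hstep P k) th j.+1) - v i t) ^+ 2)
      (mesh P k j) (mesh P k j.+1) <= etas] by near: k; exact: samp.
have goodk j : (0 < j <= k)%N -> dynamics_at P zbar v (sample_time (hstep P k) th j).
  move=> jk; apply: goodP; last by apply: nZ; case/andP: jk.
  by rewrite in_itv/=; exact: (sample_time_itv k2 th0h).
exists (sampled_traj P zbar v k th).
have slopeE := y_slopeE k2 th0h v0 goodk.
have mod' i s0 t : - T <= s0 -> s0 <= t -> t <= T -> t - s0 <= 2 * hstep P k ->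
  `|zbar (Num.max 0 t) 0 i - zbar (Num.max 0 s0) 0 i| <= w.
  by move=> a1 a2 a3 a4; apply: modulus => //; exact: le_trans h4.
apply: (sampled_traj_feasible k2 th0h v0 goodk init inity).
- move=> j jk; apply: (le_trans (enorm_le_norm _)).
  have H : `|sampled_traj P zbar v k th j - zbar (mesh P k j)| <= e2.
    exact: (sampled_traj_close lv v0 zv k2 th0h h1 slopeE L0 (ltW w0) kap0 zB lip mod' S1
      small eta1 small2).
  apply: (@le_trans _ _ (N.+1%:R * e2)); first by rewrite ler_pM2l.
  by rewrite /e2 mulrC divfK// gt_eqF.
- have H := sampled_traj_gap lv v0 zv dz k2 th0h h1 slopeE L0 (ltW w0) kap0 zB lip mod' S1 S2
    small eta1 small3.
  apply: (le_trans H); rewrite lee_fin.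
  have -> : eps / 2 = N.+1%:R * e2 by rewrite /e2 [RHS]mulrC divfK// gt_eqF.
  by rewrite ler_pM2r// ler_nat.
Unshelve. all: by end_near. Qed.

End existence.

(** * Continuity and closedness of the discrete constraints *)

Section continuity.
Context {R : realType} {X : topologicalType}.

Lemma continuous_rV N (f : X -> 'rV[R]_N) :
  (forall i, continuous (fun x => f x 0 i)) -> continuous f.
Proof.
move=> H x; apply/cvgrPdist_le => e e0.
have Hn i : \forall y \near x, `|f x 0 i - f y 0 i| <= e.
  by move/cvgrPdist_le: (H i x); apply.
near=> y; apply: rV_normP => [|i]; first exact: ltW.
by rewrite rVBE; move: i; near: y; exact: filter_forall.
Unshelve. all: by end_near. Qed.

Lemma continuous_coord N (f : X -> 'rV[R]_N) i : continuous f ->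
  continuous (fun x => f x 0 i).
Proof.
move=> cf x; apply: (@continuous_comp _ _ _ f (fun v : 'rV[R]_N => v 0 i)).
  exact: cf.
exact: coord_continuous.
Qed.

Lemma continuous_row_mx p q (f : X -> 'rV[R]_p) (g : X -> 'rV[R]_q) :
  continuous f -> continuous g -> continuous (fun x => row_mx (f x) (g x)).
Proof.
move=> cf cg; apply: continuous_rV => i.
case: (split_ordP i) => j ->.
  have -> : (fun x => row_mx (f x) (g x) 0 (lshift q j)) = (fun x => f x 0 j).
    by apply/funext => x; rewrite row_mxEl.
  exact: continuous_coord.
have -> : (fun x => row_mx (f x) (g x) 0 (rshift p j)) = (fun x => g x 0 j).
  by apply/funext => x; rewrite row_mxEr.
exact: continuous_coord.
Qed.

Lemma continuous_big_sum (I : Type) (r : seq I) (F : I -> X -> R) :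
  (forall i, continuous (F i)) -> continuous (fun x => \sum_(i <- r) F i x).
Proof.
move=> cF; elim: r => [|i r IH].
  have -> : (fun x => \sum_(i <- [::]) F i x) = (fun=> 0).
    by apply/funext => x; rewrite big_nil.
  by move=> x; exact: cst_continuous.
have -> : (fun x => \sum_(l <- i :: r) F l x) = (fun x => F i x + \sum_(l <- r) F l x).
  by apply/funext => x; rewrite big_cons.
by move=> x; apply: (@continuousD _ _ _ (F i)); [exact: cF|exact: IH].
Qed.

Lemma continuous_enorm N (f : X -> 'rV[R]_N) : continuous f ->
  continuous (fun x => enorm (f x)).
Proof.
move=> cf x; apply: (@continuous_comp _ _ _ (fun x => dotp (f x) (f x)) (@Num.sqrt R)).
  apply: continuous_big_sum => i y.
  by apply: (@continuousM _ _ (fun x => f x 0 i)); exact: continuous_coord.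
exact: sqrt_continuous.
Qed.

Lemma closed_eq_fun N (f g : X -> 'rV[R]_N) : continuous f -> continuous g ->
  closed [set x | f x = g x].
Proof.
move=> cf cg.
have -> : [set x | f x = g x] = (fun x => `|f x - g x|) @^-1` [set r : R | r <= 0].
  apply/seteqP; split => x /=; first by move->; rewrite subrr normr0.
  by rewrite normr_le0 subr_eq0 => /eqP.
apply: preimage_closed; last exact: closed_le.
move=> x _; apply: (@continuous_comp _ _ _ (fun x => f x - g x)); last exact: norm_continuous.
by apply: (@continuousB _ _ _ f g); [exact: cf|exact: cg].
Qed.

Lemma closed_le_fun (f : X -> R) (a : R) : continuous f -> closed [set x | f x <= a].
Proof.
move=> cf; apply: (@preimage_closed _ _ f [set r | r <= a]); last exact: closed_le.
by move=> x _; exact: cf.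
Qed.

Lemma closed_forall (I : Type) (Q : I -> set X) : (forall i, closed (Q i)) ->
  closed [set x | forall i, Q i x].
Proof.
move=> cQ; have -> : [set x | forall i, Q i x] = \bigcap_(i in setT) Q i.
  by apply/seteqP; split => [x H i _|x H i]; [exact: H|exact: H].
exact: closed_bigI.
Qed.

Lemma closed_forall_in (k : nat) (Q : nat -> set X) :
  (forall i, (i < k)%N -> closed (Q i)) ->
  closed [set x | forall i, (i < k)%N -> Q i x].
Proof.
move=> cQ; have -> : [set x | forall i, (i < k)%N -> Q i x] =
    \bigcap_(i in [set i | (i < k)%N]) Q i.
  by apply/seteqP; split.
exact: closed_bigI.
Qed.

End continuity.

Section block_continuity.
Context {R : realType} {n m d : nat} {X : topologicalType}.
Variable f : X -> zvec R n m d.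
Hypothesis cf : continuous f.

Lemma continuous_zx : continuous (fun x => zx (f x)).
Proof.
apply: continuous_rV => i; have -> : (fun x => zx (f x) 0 i) = (fun x => f x 0 (ix i)).
  by apply/funext => x; rewrite zxE.
exact: continuous_coord.
Qed.
Lemma continuous_zy : continuous (fun x => zy (f x)).
Proof.
apply: continuous_rV => i; have -> : (fun x => zy (f x) 0 i) = (fun x => f x 0 (iy i)).
  by apply/funext => x; rewrite zyE.
exact: continuous_coord.
Qed.
Lemma continuous_zu : continuous (fun x => zu (f x)).
Proof.
apply: continuous_rV => i; have -> : (fun x => zu (f x) 0 i) = (fun x => f x 0 (iu i)).
  by apply/funext => x; rewrite zuE.
exact: continuous_coord.
Qed.
Lemma continuous_za : continuous (fun x => za (f x)).
Proof.
apply: continuous_rV => i; have -> : (fun x => za (f x) 0 i) = (fun x => f x 0 (ia i)).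
  by apply/funext => x; rewrite zaE.
exact: continuous_coord.
Qed.
Lemma continuous_zb : continuous (fun x => zb (f x)).
Proof.
apply: continuous_rV => i; have -> : (fun x => zb (f x) 0 i) = (fun x => f x 0 (ib i)).
  by apply/funext => x; rewrite zbE.
exact: continuous_coord.
Qed.

Lemma continuous_zxuab : continuous (fun x => zxuab (f x)).
Proof.
apply: continuous_row_mx; first exact: continuous_zx.
apply: continuous_row_mx; first exact: continuous_zu.
by apply: continuous_row_mx; [exact: continuous_za|exact: continuous_zb].
Qed.

End block_continuity.

Section discrete_closed.
Context {R : realType} {n m d s : nat}.
Variables (P : problem R n m d s) (zbar : R -> zvec R n m d).
Local Notation T := (horizon P).
Local Notation N := (n + (n + (n + (m + d))))%N.
Local Notation mu := (@lebesgue_measure R).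
Variable v : 'I_N -> R -> R.
Hypothesis lv : forall i, L2loc (v i).
Hypothesis dz : {ae mu, forall t, t \in `[0, T] ->
  forall i, derive1 zbar t 0 i = v i t}.
Variable k : nat.
Hypothesis k0 : (0 < k)%N.
Local Notation h := (hstep P k).
Local Notation mesh := (mesh P k).

Let h0 : 0 < h. Proof. exact: hstep_gt0. Qed.

Let mesh_itv j : (j <= k)%N -> 0 <= mesh j <= T. Proof. exact: mesh_itv. Qed.

Let mesh_le j : mesh j <= mesh j.+1. Proof. exact: mesh_le. Qed.

(** The velocity gap as a real number: the sum over the steps and the coordinates
    of quadratic polynomials in the difference quotients. *)
Definition rgap (z : nat -> zvec R n m d) : R :=
  \sum_(j < k) \sum_(i < N)
    itg (fun t => (dquot P k z j 0 i - v i t) ^+ 2) (mesh j) (mesh j.+1).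

Lemma velocity_gapE z : velocity_gap P zbar k z = (rgap z)%:E.
Proof.
rewrite /velocity_gap /rgap -sumEFin; apply: eq_bigr => j _.
have /andP[m0 _] := mesh_itv (ltnW (ltn_ord j)).
have /andP[_ mT] := mesh_itv (ltn_ord j).
exact: (integral_gap lv dz).
Qed.

(* a family of discrete trajectories whose nodes depend continuously on a
   parameter in [X] *)
Context {X : topologicalType}.
Variable Z : X -> nat -> zvec R n m d.
Hypothesis cZ : forall j, continuous (fun x => Z x j).

Lemma continuous_dquot j : continuous (fun x => dquot P k (Z x) j).
Proof.
move=> x; apply: (@continuousZr _ _ _ (fun x => Z x j.+1 - Z x j) h^-1).
by apply: (@continuousB _ _ _ (fun x => Z x j.+1)); exact: cZ.
Qed.

Lemma continuous_rgap : continuous (fun x => rgap (Z x)).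
Proof.
apply: continuous_big_sum => j; apply: continuous_big_sum => i x.
apply: (@continuous_comp _ _ _ (fun x => dquot P k (Z x) j 0 i)
  (fun q => itg (fun t => (q - v i t) ^+ 2) (mesh j) (mesh j.+1))).
  by apply: continuous_coord; exact: continuous_dquot.
exact: continuous_itg_sqr.
Qed.

Lemma lsc_Jk : H3 P zbar -> lower_semicontinuous (fun x => Jk P zbar k (Z x)).
Proof.
move=> [lphi ll _ _ _]; rewrite /Jk.
apply: lscD; first apply: lscD.
- by apply: (lsc_comp (continuous_zx (@cZ k))).
- apply: lscZ => //; apply: lsc_sum => j; rewrite /lrun.
  apply: (@lsc_comp _ _ _ (fun x => row_mx (zxuab (Z x j)) (zxuab (dquot P k (Z x) j)))).
    apply: continuous_row_mx; apply: continuous_zxuab => //.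
    exact: continuous_dquot.
  by apply: ll; rewrite in_itv/=; exact: mesh_itv (ltnW (ltn_ord j)).
- apply: lscZ; first by rewrite invr_gt0.
  have -> : (fun x => velocity_gap P zbar k (Z x)) = (fun x => (rgap (Z x))%:E).
    by apply/funext => x; exact: velocity_gapE.
  by apply: lsc_EFin; exact: continuous_rgap.
Qed.

(** The inclusion constraint is closed because it says that an explicit vector
    [nu], continuous in the trajectory, is a limiting normal to C at x - u. *)
Lemma closed_feasible_k eps : closed (Cset P) -> continuous (f1 P) ->
  continuous (f2 P) -> closed [set x | feasible_k P zbar eps k (Z x)].
Proof.
move=> cC cf1 cf2.
have cx j := continuous_zx (@cZ j); have cy j := continuous_zy (@cZ j).
have cu j := continuous_zu (@cZ j); have ca j := continuous_za (@cZ j).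
have cb j := continuous_zb (@cZ j).
(* the only candidate for the normal vector in the inclusion constraint *)
pose nu x j := h^-1 *: (zx (Z x j) - zx (Z x j.+1)) -
  f1ax P (za (Z x j)) (zx (Z x j)) - zy (Z x j.+1).
pose Q1 j := [set x | normal_cone (Cset P) (zx (Z x j) - zu (Z x j)) (nu x j)].
pose Q2 j := [set x | zy (Z x j.+1) = zy (Z x j) + h *: f2bx P (zb (Z x j)) (zx (Z x j))].
pose Q5 j := [set x | enorm (Z x j - zbar (mesh j)) <= eps / 2].
have -> : [set x | feasible_k P zbar eps k (Z x)] =
  [set x | forall j, (j < k)%N -> Q1 j x] `&` [set x | forall j, (j < k)%N -> Q2 j x] `&`
  ([set x | zx (Z x 0%N) = x0 P] `&` [set x | zy (Z x 0%N) = 0] `&`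
   [set x | zu (Z x 0%N) = zu (zbar 0)] `&` [set x | za (Z x 0%N) = za (zbar 0)] `&`
   [set x | zb (Z x 0%N) = zb (zbar 0)]) `&`
  [set x | Cset P (zx (Z x k) - zu (Z x k))] `&`
  ([set x | forall j, (j < k)%N -> Q5 j x] `&` [set x | rgap (Z x) <= eps / 2]).
  have Q1E x j : Q1 j x <->
      [set zx (Z x j) - h *: w | w in Fh P (Z x) j] (zx (Z x j.+1)).
    have cone_eq u : normal_cone (Cu P (zu (Z x j))) (zx (Z x j)) u <->
        normal_cone (Cset P) (zx (Z x j) - zu (Z x j)) u.
      have := @normal_cone_shift R n (Cset P) (zu (Z x j)) (zx (Z x j) - zu (Z x j)) u.
      by rewrite subrK.
    split=> [H|[_ [u Hu <-] E]].
      exists (nu x j + f1ax P (za (Z x j)) (zx (Z x j)) + zy (Z x j.+1)).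
        by exists (nu x j) => //; exact/cone_eq.
      by apply/rowP => i; rewrite !mxE; field; rewrite gt_eqF.
    rewrite /Q1 /=; have -> : nu x j = u; last exact/cone_eq.
    rewrite /nu -E; apply/rowP => i; rewrite !mxE; field.
    by rewrite gt_eqF.
  apply/seteqP; split => x.
    move=> [H1 H2 [? ? ? ? ?] H4 [H5 H6]]; split; last first.
      by split => //; move: H6; rewrite velocity_gapE lee_fin.
    split => //; split => //; split => // j jk; exact/Q1E/H1.
  move=> [[[[H1 H2] [[[[? ?] ?] ?] ?]] H4] [H5 H6]]; split => //.
  - by move=> j jk; apply/Q1E; exact: H1.
  - by split => //; rewrite velocity_gapE lee_fin.
have cf1ax j : continuous (fun x => f1ax P (za (Z x j)) (zx (Z x j))).
  move=> x; apply: (@continuous_comp _ _ _ (fun x => row_mx (za (Z x j)) (zx (Z x j))) (f1 P)).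
    exact: continuous_row_mx.
  exact: cf1.
have cf2bx j : continuous (fun x => f2bx P (zb (Z x j)) (zx (Z x j))).
  move=> x; apply: (@continuous_comp _ _ _ (fun x => row_mx (zb (Z x j)) (zx (Z x j))) (f2 P)).
    exact: continuous_row_mx.
  exact: cf2.
have cxu j : continuous (fun x => zx (Z x j) - zu (Z x j)).
  by move=> x; apply: (@continuousB _ _ _ (fun x => zx (Z x j))); [exact: cx|exact: cu].
have cnu j : continuous (fun x => nu x j).
  have c1 : continuous (fun x => h^-1 *: (zx (Z x j) - zx (Z x j.+1))).
    move=> x; apply: (@continuousZr _ _ _ (fun x => zx (Z x j) - zx (Z x j.+1)) h^-1).
    by apply: (@continuousB _ _ _ (fun x => zx (Z x j))); exact: cx.
  move=> x; exact: (continuousB (continuousB (@c1 x) (@cf1ax j x)) (@cy j.+1 x)).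
have cst N' (c : 'rV[R]_N') : continuous (fun _ : X => c).
  by move=> x; exact: cst_continuous.
repeat apply: closedI.
- apply: closed_forall_in => j _.
  apply: (@preimage_closed _ _ (fun x => (zx (Z x j) - zu (Z x j), nu x j))
    [set p | normal_cone (Cset P) p.1 p.2]); last exact: closed_normal_cone.
  by move=> x _; exact: (cvg_pair (@cxu j x) (@cnu j x)).
- apply: closed_forall_in => j _; apply: closed_eq_fun; first exact: cy.
  move=> x; apply: (@continuousD _ _ _ (fun x => zy (Z x j))); first exact: cy.
  by apply: (@continuousZr _ _ _ (fun x => f2bx P (zb (Z x j)) (zx (Z x j))) h); exact: cf2bx.
- exact: closed_eq_fun.
- exact: closed_eq_fun.
- exact: closed_eq_fun.
- exact: closed_eq_fun.
- exact: closed_eq_fun.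
- by apply: (@preimage_closed _ _ (fun x => zx (Z x k) - zu (Z x k))) => // x _; exact: cxu.
- apply: closed_forall_in => j _; apply: closed_le_fun; apply: continuous_enorm => x.
  by apply: (@continuousB _ _ _ (fun x => Z x j)); [exact: cZ|exact: cst].
- by apply: closed_le_fun; exact: continuous_rgap.
Qed.

End discrete_closed.

(** * Existence of optimal discrete trajectories *)

Section truncation.
Context {R : realType} {n m d s : nat}.
Variables (P : problem R n m d s) (zbar : R -> zvec R n m d) (k : nat).
Implicit Types z : nat -> zvec R n m d.

Let eq_dquot z z' : (forall j, (j <= k)%N -> z j = z' j) ->
  forall j, (j < k)%N -> dquot P k z j = dquot P k z' j.
Proof. by move=> E j jk; rewrite /dquot !E// ltnW. Qed.

Let eq_gap z z' : (forall j, (j <= k)%N -> z j = z' j) ->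
  velocity_gap P zbar k z = velocity_gap P zbar k z'.
Proof.
move=> E; apply: eq_bigr => j _; apply: eq_integral => t _.
by rewrite (eq_dquot E).
Qed.

Lemma eq_Jk z z' : (forall j, (j <= k)%N -> z j = z' j) ->
  Jk P zbar k z = Jk P zbar k z'.
Proof.
move=> E; have Ek := E k (leqnn k); rewrite /Jk Ek (eq_gap E).
suff -> : (\sum_(j < k) lrun P (mesh P k j) (z j) (dquot P k z j) =
  \sum_(j < k) lrun P (mesh P k j) (z' j) (dquot P k z' j))%E by [].
apply: eq_bigr => j _.
by rewrite (eq_dquot E (ltn_ord j)) (E j (ltnW (ltn_ord j))).
Qed.

(** Only the nodes up to the index [k] matter. *)
Lemma eq_feasible_k eps z z' : (forall j, (j <= k)%N -> z j = z' j) ->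
  feasible_k P zbar eps k z -> feasible_k P zbar eps k z'.
Proof.
move=> E [H1 H2 H3 H4 [H5 H6]]; split.
- by move=> j jk; have := H1 j jk; rewrite /Fh (E j (ltnW jk)) (E j.+1 jk).
- by move=> j jk; have := H2 j jk; rewrite (E j (ltnW jk)) (E j.+1 jk).
- by move: H3; rewrite (E 0%N (leq0n k)).
- by move: H4; rewrite (E k (leqnn k)).
- split; last by rewrite -(eq_gap E).
  by move=> j jk; have := H5 j jk; rewrite (E j (ltnW jk)).
Qed.

End truncation.

Section bounded.
Context {R : realType} {n m d s : nat}.
Variables (P : problem R n m d s) (zbar : R -> zvec R n m d).
Local Notation T := (horizon P).
Local Notation N := (n + (n + (n + (m + d))))%N.
Local Notation mu := (@lebesgue_measure R).
Variable v : 'I_N -> R -> R.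
Hypothesis lv : forall i, L2loc (v i).
Hypothesis dz : {ae mu, forall t, t \in `[0, T] ->
  forall i, derive1 zbar t 0 i = v i t}.

(** The nodes before the last one are in the tube around [zbar]; the last one is
    bounded by the velocity gap over the last mesh interval. *)
Lemma feasible_k_bounded eps k : 0 < eps -> (0 < k)%N -> exists r : nat -> R,
  forall z, feasible_k P zbar eps k z -> forall j, (j <= k)%N -> `|z j| <= r j.
Proof.
move=> eps0; case: k => // k _; set h := hstep P k.+1.
have h0 : 0 < h by rewrite /h /hstep divr_gt0 ?ltr0n// horizon_gt0.
pose a := mesh P k.+1 k; pose b := mesh P k.+1 k.+1.
have ab : b - a = h by rewrite /a /b /mesh -/h -natr1; ring.
have ab' : a <= b by lra.
pose M := \sum_(i < N) itg (fun t => v i t ^+ 2) a b.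
have Mi i : itg (fun t => v i t ^+ 2) a b <= M.
  rewrite /M (bigD1 i)//= lerDl; apply: sumr_ge0 => j _.
  by apply: itg_ge0 => t; exact: sqr_ge0.
pose r0 j := `|zbar (mesh P k.+1 j)| + eps / 2.
pose rq := 1 + (eps + 2 * M) / h.
exists (fun j => if (j == k.+1)%N then r0 k + h * rq else r0 j).
move=> z [_ _ _ _ [H5 H6]] j.
have zj l : (l < k.+1)%N -> `|z l| <= r0 l.
  move=> lk; rewrite -(subrK (zbar (mesh P k.+1 l)) (z l)) addrC.
  rewrite (le_trans (ler_normD _ _))// lerD2l (le_trans (norm_le_enorm _))//.
  exact: H5.
rewrite leq_eqVlt => /orP[/eqP ->|jk]; last by rewrite ltn_eqF//; exact: zj.
rewrite eqxx.
set q := dquot P k.+1 z k.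
have zk : z k.+1 = z k + h *: q.
  by rewrite /q /dquot scalerA mulfV ?gt_eqF// scale1r addrC subrK.
rewrite zk (le_trans (ler_normD _ _))// lerD ?zj//.
rewrite normrZ gtr0_norm// ler_pM2l//.
have lq i : locint (fun t => (q 0 i - v i t) ^+ 2).
  by have [] : L2loc (fun t => q 0 i - v i t) by apply: L2locB => //; exact: L2loc_cst.
have gi i : itg (fun t => (q 0 i - v i t) ^+ 2) a b <= eps / 2.
  move: H6; rewrite (velocity_gapE lv dz)// lee_fin; apply: le_trans.
  have g0 j' i' : 0 <= itg (fun t => (dquot P k.+1 z j' 0 i' - v i' t) ^+ 2)
      (mesh P k.+1 j') (mesh P k.+1 j'.+1).
    by apply: itg_ge0 => t; exact: sqr_ge0.
  rewrite /rgap (bigD1 ord_max)//= (bigD1 i)//= -addrA lerDl.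
  by rewrite addr_ge0//; apply: sumr_ge0 => // j' _; exact: sumr_ge0.
(* [q^2 <= 2 (q - v)^2 + 2 v^2], integrated over the last mesh interval *)
have qi i : h * (q 0 i) ^+ 2 <= eps + 2 * M.
  have lvi := L2loc_sqr (lv i).
  rewrite -ab -itg_cst//.
  apply: (@le_trans _ _ (itg (fun t => 2 * (q 0 i - v i t) ^+ 2 + 2 * v i t ^+ 2) a b)).
    apply: le_itg; [exact: locint_cst|by apply: locintD; exact: locintZ|].
    by move=> t _; have := sqr_ge0 (q 0 i - 2 * v i t); nra.
  rewrite itgD ?itgZ//; try exact: locintZ.
  by have := gi i; have := Mi i; lra.
have M0 : 0 <= M.
  by apply: sumr_ge0 => i _; apply: itg_ge0 => t; exact: sqr_ge0.
have c0 : 0 <= (eps + 2 * M) / h by rewrite divr_ge0// ?ltW//; lra.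
apply: rV_normP; first by rewrite /rq; lra.
move=> i; rewrite /rq.
have : q 0 i ^+ 2 <= (eps + 2 * M) / h by rewrite ler_pdivlMr// mulrC.
rewrite -real_normK ?num_real//; have := normr_ge0 (q 0 i); nra.
Qed.

End bounded.

Section minimizers.
Context {R : realType} {n m d s : nat}.
Variables (P : problem R n m d s) (zbar : R -> zvec R n m d).
Local Notation T := (horizon P).

(** A lower semicontinuous cost attains its minimum on a compact nonempty set. The
    compactness comes from Tychonoff's theorem for the product of the balls that
    contain the nodes; nodes after the [k]-th are set to 0. *)
Lemma optimal_k_exists eps k : 0 < eps -> (0 < k)%N -> W12 T zbar ->
  continuous (f1 P) -> continuous (f2 P) -> H3 P zbar ->
  (exists z, feasible_k P zbar eps k z) -> exists z, optimal_k P zbar eps k z.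
Proof.
move=> eps0 k0 W cf1 cf2 h3 [zf fzf].
have [v [lv _ _ dz]] := W12_density (horizon_gt0 P) W.
have [r Hr] := feasible_k_bounded lv dz eps0 k0.
have cC : closed (Cset P).
  have [/(_ _ k0)[_ [nu Hnu _] _] _ _ _ _] := fzf.
  exact: normal_cone_closed_Cset Hnu.
pose X : topologicalType := {ptws nat -> zvec R n m d}.
pose Z (x : X) (j : nat) : zvec R n m d := x j.
have cZ j : continuous (fun x => Z x j).
  exact: (@proj_continuous nat (fun _ => zvec R n m d) j).
pose trunc (z : nat -> zvec R n m d) : X := fun j => if (j <= k)%N then z j else 0.
have truncE z j : (j <= k)%N -> z j = Z (trunc z) j by rewrite /Z /trunc => ->.
pose F := [set x : X | feasible_k P zbar eps k (Z x)] `&`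
          [set x : X | forall j, (k < j)%N -> Z x j = 0].
have Ftrunc z : feasible_k P zbar eps k z -> F (trunc z).
  move=> fz; split; first exact: eq_feasible_k (truncE z) fz.
  by move=> j kj; rewrite /Z /trunc leqNgt kj.
pose K (j : nat) : set (zvec R n m d) :=
  [set p | `|p| <= if (j <= k)%N then r j else 0].
have cK j : compact (K j).
  apply: bounded_closed_compact.
    exists (if (j <= k)%N then r j else 0); split; first exact: num_real.
    by move=> M /ltW rM p /= /le_trans; apply.
  apply: (@closed_le_fun R (zvec R n m d) (fun p => `|p|)); exact: norm_continuous.
have cF : compact F.
  apply: subclosed_compact (tychonoff cK) _.
    apply: closedI; first exact: (closed_feasible_k lv dz).
    apply: closed_forall => j; case: (ltnP k j) => kj; last first.
      have -> : (fun x : X => false -> Z x j = 0) = setT by apply/seteqP; split.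
      exact: closedT.
    have -> : (fun x : X => true -> Z x j = 0) = [set x : X | Z x j = 0].
      by apply/seteqP; split => x /=; [exact|].
    apply: closed_eq_fun => //; by move=> x; exact: cst_continuous.
  move=> x [fx x0] j; rewrite /K /=; case: leqP => [jk|kj]; first exact: (Hr _ fx).
  by have := x0 _ kj; rewrite /Z => ->; rewrite normr0.
have F0 : F !=set0 by exists (trunc zf); exact: Ftrunc.
have [x [fx _] xmin] := compact_lsc_min (lsc_Jk lv dz k0 cZ h3) cF F0.
exists (Z x); split; first exact: fx.
move=> z' fz'; rewrite (eq_Jk P zbar (truncE z')).
exact: (xmin _ (Ftrunc _ fz')).
Qed.

End minimizers.

Theorem proposition5p1 (R : realType) (n m d s : nat) (P : problem R n m d s)
  (zbar : R -> zvec R n m d) (eps : R)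
  (hzbar : rilm P zbar eps)
  (h1 : H1 P) (h2 : H2 P) (h3 : H3 P zbar) :
  \forall k \near \oo, exists z : nat -> zvec R n m d,
    optimal_k P zbar eps k z.
Proof.
have [fz _ eps0 _] := hzbar; have [cf1 cf2 _ HL] := h2.
have := feasible_k_exists fz HL eps0.
have [W _ _ _ _] := fz.
apply: filterS2 (nbhs_infty_gt 0) => k k0 fk.
exact: optimal_k_exists.
Qed.
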